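(* Let $(Z_n)_{n\ge0}$ be a BPIRE (as in the context) with offspring p.g.f. $\varphi_n$ and $M_n$ immigrants in generation $n$, which is an irreducible Markov chain under $Q$ (on state space $\mathbb{N}$ or $\mathbb{N}_0$). Assume: (1) $(\varphi_n,M_n)_{n\in\mathbb{N}}$ is i.i.d. under $Q$; (2) with $\mu_n:=\varphi_n'(1)$, $E_Q[|\log\mu_1|^{\delta}]<\infty$ for every $0<\delta<6$ and $E_Q[\log\mu_1]=0$; (3) $E_Q\big[\big(\log_+(\operatorname{Var}_{\varphi}(\xi^{(1)}_1)\cdot\mu_1^{-2})\big)^2\big]<\infty$; (4) $\liminf_{t\to\infty}\big(t^{\lambda}\cdot Q[\log M_1>t]\big)>0$ for some $0<\lambda<2$. Then $(Z_n)_{n\ge0}$ is transient.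
   Context: Branching process in random environment with immigration (BPIRE): the environment is a sequence $(\varphi_n,M_n)_{n\in\mathbb{N}}$ of pairs, where $\varphi_n$ is a (random) probability generating function of a distribution on $\mathbb{N}_0$ and $M_n$ is an $\mathbb{N}_0$-valued random variable, defined on a probability space with measure $Q$. Conditionally on the environment, $\{\xi^{(n)}_j: j,n\in\mathbb{N}\}$ are independent, with $\xi^{(n)}_j$ having p.g.f. $\varphi_n$. Set $Z_0:=0$ and $Z_n:=\xi^{(n)}_1+\dots+\xi^{(n)}_{Z_{n-1}}+M_n$ for $n\ge1$. Under $Q$, $(Z_n)$ is a time-homogeneous Markov chain; recurrence/transience refer to this chain. $Q_\varphi:=Q[\cdot\mid(\varphi_n)_n]$ and $\operatorname{Var}_\varphi$ denotes variance under $Q_\varphi$ (so $\operatorname{Var}_\varphi(\xi^{(1)}_1)$ is the variance of the distribution with p.g.f. $\varphi_1$). $\log_+x=\max(\log x,0)$. *)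

(* Defs.v *)
From HB Require Import structures.
From mathcomp Require Import all_boot all_order all_algebra.
From mathcomp Require Import all_classical all_reals all_analysis.
Set Implicit Arguments. Unset Strict Implicit. Unset Printing Implicit Defensive.
Import Order.TTheory GRing.Theory Num.Theory.
Import numFieldNormedType.Exports.
Local Open Scope classical_set_scope.
Local Open Scope ring_scope.

Section BPIRE.
Variable R : realType.

(* An environment value: a probability mass function on N_0 (the offspring
   law, whose p.g.f. is phi) together with a number of immigrants. *)
Definition envval := ((nat -> R) * nat)%type.

Definition env_gen : set (set envval) :=
  [set A | exists k (B : set R), measurable B /\ A = [set v | B (v.1 k)]] `|`
  [set A | exists m : nat, A = [set v | v.2 = m]].

Definition env_meas : set (set envval) := <<s env_gen >>.

Fixpoint convn (p : nat -> R) (x : nat) (y : nat) : R :=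
  match x with
  | 0 => (y == 0)%:R
  | x'.+1 => \sum_(i < y.+1) convn p x' i * p (y - i)%N
  end.

(* quenched one-step transition probability: Q_phi(xi_1+...+xi_x + M = y) *)
Definition qstep (v : envval) (x y : nat) : R :=
  if (v.2 <= y)%N then convn v.1 x (y - v.2) else 0.

Definition shift_env (e : nat -> envval) : nat -> envval := fun i => e i.+1.

Local Open Scope ereal_scope.

(* quenched n-step transition probability, environment e (e 0 = generation 1) *)
Fixpoint qnstep (n : nat) (e : nat -> envval) (x y : nat) : \bar R :=
  match n with
  | 0 => ((x == y)%:R)%:E
  | n'.+1 => \sum_(k <oo) ((qstep (e 0%N) x k)%:E * qnstep n' (shift_env e) k y)
  end.

Fixpoint qhit (n : nat) (e : nat -> envval) (x t : nat) : \bar R :=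
  match n with
  | 0 => 0
  | 1 => (qstep (e 0%N) x t)%:E
  | n'.+1 => \sum_(k <oo)
              (((k != t)%:R * qstep (e 0%N) x k)%:E * qhit n' (shift_env e) k t)
  end.

Section Annealed.
Variables (d : measure_display) (Omega : measurableType d)
          (Q : probability Omega R) (env : nat -> Omega -> envval).

Definition env_iid : Prop :=
  (forall i B, env_meas B -> Q (env i @^-1` B) = Q (env 0%N @^-1` B)) /\
  (forall (s : seq nat) (B : nat -> set envval), uniq s ->
     (forall i, env_meas (B i)) ->
     Q (\bigcap_(i in [set` s]) (env i @^-1` B i)) =
     \prod_(i <- s) Q (env i @^-1` B i)).

Definition envseq (w : Omega) : nat -> envval := fun i => env i w.

Definition pn (n : nat) (x y : nat) : \bar R :=
  \int[Q]_w qnstep n (envseq w) x y.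

Definition return_prob (x : nat) : \bar R :=
  \sum_(n <oo) \int[Q]_w qhit n.+1 (envseq w) x x.

Definition transient_state (x : nat) : Prop := return_prob x < 1.

Definition irreducible_on (S : set nat) : Prop :=
  forall x y, S x -> S y -> exists n, 0 < pn n x y.
End Annealed.

(* mu = phi'(1) = sum_k k p_k (possibly +oo) *)
Definition mean (p : nat -> R) : \bar R := \sum_(k <oo) ((k%:R * p k)%R)%:E.
Definition second_moment (p : nat -> R) : \bar R :=
  \sum_(k <oo) (((k%:R) ^+ 2 * p k)%R)%:E.

Definition variance (p : nat -> R) : \bar R :=
  match mean p with
  | r%:E => second_moment p - ((r ^+ 2)%R)%:E
  | _ => +oo
  end.

Definition elog (x : \bar R) : \bar R :=
  match x with
  | r%:E => if (r <= 0)%R then -oo else (ln r)%:E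
  | +oo => +oo
  | -oo => -oo
  end.

Definition logplus (x : \bar R) : \bar R :=
  match x with
  | r%:E => if (1 < r)%R then (ln r)%:E else 0
  | +oo => +oo
  | -oo => 0
  end.

(* Var_phi(xi) * mu^{-2}; the value when mu is 0 or +oo is irrelevant
   (a Q-null event under hypothesis (2)) and is set to +oo *)
Definition var_ratio (p : nat -> R) : \bar R :=
  match mean p with
  | r%:E => if (0 < r)%R then variance p * ((r ^- 2)%R)%:E else +oo
  | _ => +oo
  end.

End BPIRE.

(* Main.v *)
Require Import Defs.
From HB Require Import structures.
From mathcomp Require Import all_boot all_order all_algebra.
From mathcomp Require Import all_classical all_reals all_analysis.
From mathcomp Require Import measurable_realfun.
From mathcomp Require Import ring lra zify.
Set Implicit Arguments. Unset Strict Implicit. Unset Printing Implicit Defensive.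
Import Order.TTheory GRing.Theory Num.Theory.
Import numFieldNormedType.Exports.
Local Open Scope classical_set_scope.
Local Open Scope ring_scope.

(** In almost every environment the largest immigration up to time [n] beats the
fluctuations of the walk [S_n = log mu_1 + ... + log mu_n], because
[log M] has a tail heavier than [t^-2] while [S_n = o(n^(1/2+eps))].

Quenched estimate. If [p] has mean [mu] and second moment [m2], its p.g.f. [f]
satisfies [1/(1 - f(1 - 1/a)) <= a/mu + m2/mu^2]. Iterating this over the generations
after an immigration of size [M] bounds the probability to be at [x] later on by
[2^x a/M], where [a] is a sum of terms [(m2_i/mu_i^2) exp(-(S_i - S_j))].

Scales. Along [n = 2^m], with [rho^m] between the two growth rates, Borel-Cantelli
shows that almost surely for all large [m]: the walk stays below [(m+3) rho^m] up to
time [2^(m+2)] (a union bound over dyadic blocks, which only uses that the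
increments are orthogonal), so do the [log+ (Var_i/mu_i^2)], and some immigration in
[[2^m, 2^(m+1))] exceeds [exp(4(m+3) rho^m)]. Hence for almost every environment
there is a starting generation [k] from which the quenched return probability to
[x] is at most [1/2].

Conclusion. The annealed return probability is the mean of the quenched one,
which is at most [1]. Were it [1], stationarity would make the quenched return probability
equal to [1] from every generation, almost surely. *)

(** * Quenched generating functions *)

Section Quenched.
Variable R : realType.
Implicit Types (p : nat -> R) (v : envval R) (e : nat -> envval R).

(** The induction rests on [(1 - t) * (1 + (k+1) t) = 1 + k t - (k+1) t^2]. Dividing gives
    [(1 - t)^k <= 1 / (1 + k t)], the only decay estimate for powers used below. *)
Lemma bernoulli_inv (t : R) k : 0 <= t <= 1 -> (1 - t) ^+ k * (1 + k%:R * t) <= 1.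
Proof.
move=> /andP[t0 t1]; elim: k => [|k IH]; first by rewrite expr0 mul0r addr0 mul1r.
apply: le_trans IH; rewrite exprSr -mulrA; apply: ler_wpM2l.
  by rewrite exprn_ge0// subr_ge0.
rewrite -natr1; have := mulr_ge0 (mulr_ge0 (ler0n R k.+1) t0) t0.
by rewrite -natr1; nra.
Qed.

Lemma partial_nneseries (u : nat -> R) (c : R) : (forall k, 0 <= u k) ->
  (\sum_(k <oo) (u k)%:E <= c%:E)%E <-> (forall N, \sum_(k < N) u k <= c).
Proof.
move=> u0; split=> [h N|h].
- rewrite -lee_fin -sumEFin; apply: le_trans h.
  rewrite -(big_mkord xpredT (fun i => (u i)%:E)).
  by apply: nneseries_lim_ge => k _; rewrite lee_fin.
- apply: lime_le.
    by apply: is_cvg_nneseries => k _ _; rewrite lee_fin.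
  by apply: nearW => N; rewrite big_mkord sumEFin lee_fin.
Qed.

Lemma big_ord_geq (F : nat -> R) m N :
  \sum_(y < N | (m <= y)%N) F y = \sum_(k < N - m) F (k + m)%N.
Proof.
have := big_geq_mkord (idx := 0) (op := +%R) m N xpredT F => /= <-.
by rewrite -{1}(add0n m) big_addn big_mkord.
Qed.

(** Summing the triangle [i <= y < N] over [y] first leaves, for each [i], a partial sum of [b],
    hence at most [B]. *)
Lemma cauchy_product_le (a b : nat -> R) (A B : R) N :
  (forall k, 0 <= a k) -> (forall k, 0 <= b k) ->
  (forall n, \sum_(k < n) a k <= A) -> (forall n, \sum_(k < n) b k <= B) ->
  \sum_(y < N) \sum_(i < y.+1) a i * b (y - i)%N <= A * B.
Proof.
move=> a0 b0 hA hB.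
have B0 : 0 <= B by have := hB 0%N; rewrite big_ord0.
have -> : \sum_(y < N) \sum_(i < y.+1) a i * b (y - i)%N =
    \sum_(y < N) \sum_(i < N | (i <= y)%N) a i * b (y - i)%N.
  apply: eq_bigr => y _.
  by rewrite (big_ord_widen N (fun i => a i * b (y - i)%N)).
rewrite (exchange_big_dep xpredT)//=.
apply: (@le_trans _ _ (\sum_(i < N) a i * B)); last first.
  by rewrite -mulr_suml ler_wpM2r.
apply: ler_sum => i _; rewrite -mulr_sumr ler_wpM2l//.
rewrite (big_ord_geq (fun y => b (y - i)%N)).
apply: le_trans (hB (N - i)%N).
by apply: ler_sum => k _; rewrite addnK.
Qed.

Definition is_pmf p := (forall k, 0 <= p k) /\ (\sum_(k <oo) (p k)%:E = 1)%E.

Lemma convn_ge0 p x y : (forall k, 0 <= p k) -> 0 <= convn p x y.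
Proof.
move=> p0; elim: x y => [|x IH] y /=; first by rewrite ler0n.
by apply: sumr_ge0 => i _; rewrite mulr_ge0.
Qed.

(** The p.g.f. of a sum of [x] independent copies is the [x]-th power. With partial sums and an
    upper bound [f], this becomes an induction on finite Cauchy products. *)
Lemma convn_pgf_le p x (s f : R) N : (forall k, 0 <= p k) -> 0 <= s ->
  (forall n, \sum_(k < n) p k * s ^+ k <= f) ->
  \sum_(y < N) convn p x y * s ^+ y <= f ^+ x.
Proof.
move=> p0 s0 hf; elim: x N => [|x IH] N.
  rewrite expr0; case: N => [|N]; first by rewrite big_ord0.
  rewrite big_ord_recl/= expr0 mulr1 big1 ?addr0// => i _.
  by rewrite /= mul0r.
rewrite exprSr.
rewrite (eq_bigr (fun y : 'I_N => \sum_(i < y.+1)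
    (convn p x i * s ^+ i) * (p (y - i)%N * s ^+ (y - i)))).
  apply: (@cauchy_product_le (fun i => convn p x i * s ^+ i)
    (fun i => p i * s ^+ i)) => // k.
    by rewrite mulr_ge0 ?convn_ge0 ?exprn_ge0.
  by rewrite mulr_ge0 ?exprn_ge0.
move=> y _ /=; rewrite mulr_suml; apply: eq_bigr => i _.
rewrite mulrACA -exprD subnKC//.
by rewrite -ltnS.
Qed.

Lemma qstep_ge0 v x y : (forall k, 0 <= v.1 k) -> 0 <= qstep v x y.
Proof. by move=> p0; rewrite /qstep; case: ifP => // _; exact: convn_ge0. Qed.

(** Immigration multiplies the p.g.f. by [s ^ v.2 <= 1], and this factor is dropped. The gain from a
    large immigration is taken up separately in [qnstep_immigration]. *)
Lemma qstep_pgf_le v x (s f : R) N : (forall k, 0 <= v.1 k) -> 0 <= s <= 1 ->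
  (forall n, \sum_(k < n) v.1 k * s ^+ k <= f) ->
  \sum_(y < N) qstep v x y * s ^+ y <= f ^+ x.
Proof.
move=> p0 /andP[s0 s1] hf; rewrite /qstep.
rewrite (eq_bigr (fun y : 'I_N => if (v.2 <= y)%N then
   convn v.1 x (y - v.2) * s ^+ y else 0)); last first.
  by move=> y _; case: ifP => //; rewrite mul0r.
rewrite -big_mkcond/= (big_ord_geq (fun y => convn v.1 x (y - v.2) * s ^+ y)).
apply: le_trans (convn_pgf_le x (N - v.2)%N p0 s0 hf).
apply: ler_sum => k _; rewrite addnK ler_wpM2l ?convn_ge0//.
by rewrite exprD ler_piMr ?exprn_ge0// exprn_ile1.
Qed.

Lemma qstep_sum_le1 v x N : is_pmf v.1 -> \sum_(y < N) qstep v x y <= 1.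
Proof.
move=> [p0 p1].
have h n : \sum_(k < n) v.1 k * 1 ^+ k <= 1.
  under eq_bigr do rewrite expr1n mulr1.
  by apply: (partial_nneseries 1 p0).1; rewrite p1.
have := @qstep_pgf_le v x 1 1 N p0 _ h; rewrite expr1n ler01 lexx => /(_ isT).
by under eq_bigr do rewrite expr1n mulr1.
Qed.

Local Open Scope ereal_scope.

(* [c] makes the tangent bound [u/w >= 2cu - c^2 uw] of the ratio
   [kt/(1+kt) <= 1 - (1-t)^k] sharp after averaging over [k]. *)
Lemma pgf_le p (a mu m2 : R) : is_pmf p -> (1 <= a)%R -> (0 < mu)%R ->
  mean p = mu%:E -> second_moment p = m2%:E ->
  forall n, (\sum_(k < n) p k * (1 - a^-1) ^+ k <=
    1 - (a / mu + m2 / mu ^+ 2)^-1)%R.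
Proof.
move=> [p0 p1] a1 mu0 hmu hm2.
have a0 : (0 < a)%R by rewrite (lt_le_trans _ a1).
have m20 : (0 <= m2)%R.
  rewrite -lee_fin -hm2; apply: nneseries_ge0 => k _ _.
  by rewrite lee_fin mulr_ge0// exprn_ge0.
set t := (a^-1)%R; have t0 : (0 < t)%R by rewrite invr_gt0.
have t1 : (t <= 1)%R by rewrite invf_le1.
set u := (mu * t)%R; set w := (m2 * t ^+ 2)%R.
have u0 : (0 < u)%R by rewrite mulr_gt0.
have w0 : (0 <= w)%R by rewrite mulr_ge0// exprn_ge0// ltW.
have uw0 : (0 < u + w)%R by rewrite ltr_wpDr.
set c := (u / (u + w))%R.
have c0 : (0 < c)%R by rewrite divr_gt0.
have c1 : (c <= 1)%R by rewrite ler_pdivrMr// mul1r lerDl.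
set b := ((2 * c - c ^+ 2) * t)%R.
have b0 : (0 <= b)%R by rewrite mulr_ge0//; [nra|exact: ltW].
set g := (c ^+ 2 * t ^+ 2)%R.
have g0 : (0 <= g)%R by rewrite mulr_ge0// exprn_ge0// ltW.
have s0 : (0 <= 1 - t)%R by rewrite subr_ge0.
have ps0 k : (0 <= p k * (1 - t) ^+ k)%R by rewrite mulr_ge0// exprn_ge0.
apply: (partial_nneseries _ ps0).1.
(* Pointwise inequality, later averaged over [p]. After [bernoulli_inv] the gap is at least
   [k t (1 - c (1 + k t))^2 / (1 + k t)], which is nonnegative. *)
have key k : ((1 - t) ^+ k + b * k%:R <= 1 + g * k%:R ^+ 2)%R.
  have kt0 : (0 <= k%:R * t)%R by rewrite mulr_ge0// ltW.
  have B := @bernoulli_inv t k; rewrite t1 ltW// in B; have {}B := B isT.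
  have kt1 : (0 < 1 + k%:R * t)%R by rewrite ltr_wpDr.
  have {}B : ((1 - t) ^+ k <= (1 + k%:R * t)^-1)%R by rewrite -ler_pdivlMr ?div1r in B.
  apply: (@le_trans _ _ ((1 + k%:R * t)^-1 + b * k%:R)%R); first by rewrite lerD2r.
  rewrite -subr_ge0.
  have -> : (1 + g * k%:R ^+ 2 - ((1 + k%:R * t)^-1 + b * k%:R) =
     (k%:R * t) * (1 - c * (1 + k%:R * t)) ^+ 2 / (1 + k%:R * t))%R.
    by rewrite /g /b; field; rewrite gt_eqF.
  by apply: divr_ge0; [apply: mulr_ge0 => //; exact: sqr_ge0|exact: ltW].
have S : \sum_(k <oo) (p k * (1 - t) ^+ k)%:E + (b * mu)%:E <= (1 + g * m2)%:E.
  have -> : (b * mu)%:E = \sum_(k <oo) (b * (k%:R * p k))%:E.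
    rewrite EFinM -hmu /mean -nneseriesZl//; last by move=> k _; rewrite lee_fin mulr_ge0.
  have -> : (1 + g * m2)%:E = \sum_(k <oo) (p k + g * (k%:R ^+ 2 * p k))%:E.
    rewrite EFinD -p1 EFinM -hm2 /second_moment -nneseriesZl//; last first.
      by move=> k _; rewrite lee_fin mulr_ge0// exprn_ge0.
    rewrite -nneseriesD//.
      by move=> k _ _; rewrite lee_fin.
    by move=> k _ _; rewrite mule_ge0// lee_fin// mulr_ge0// exprn_ge0.
  rewrite -nneseriesD//; first last.
  - by move=> k _ _; rewrite lee_fin mulr_ge0// mulr_ge0.
  - by move=> k _ _; rewrite lee_fin.
  apply: lee_nneseries => [k _ _|k _].
    by rewrite lee_fin addr_ge0// mulr_ge0// mulr_ge0.
  rewrite -EFinD lee_fin; have := key k; have := p0 k.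
  move=> /ler_wpM2l/[apply]; lra.
(* The choice of [c] gives [g m2 - b mu = - u^2 / (u + w)], and
   [(u + w) / u^2 = a / mu + m2 / mu^2]. *)
have -> : (1 - (a / mu + m2 / mu ^+ 2)^-1 = 1 + g * m2 - b * mu)%R.
  have at1 : (a = t^-1)%R by rewrite invrK.
  rewrite /g /b /c /w /u at1; field.
  rewrite -/u -/w; move: uw0 w0 u0; rewrite /w /u; nra.
by rewrite EFinB leeBrDr.
Qed.

End Quenched.

(** * Quenched transition bounds over many generations *)

Section Quenched2.
Variable R : realType.
Implicit Types (p : nat -> R) (v : envval R) (e : nat -> envval R).

(** The environment values to which [pgf_le] applies. Almost surely every generation is of this
    kind, by [not_good_negligible]. *)
Definition good v := [/\ is_pmf v.1, (0 < fine (mean v.1)),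
  mean v.1 = (fine (mean v.1))%:E & second_moment v.1 = (fine (second_moment v.1))%:E].

Definition moment_ratio v : R := fine (second_moment v.1) / fine (mean v.1) ^+ 2.

(* [(ecoef n e)^-1] bounds from below the quenched probability that the
   progeny after [n] generations of one individual survives a thinning at rate 1/2. *)
Fixpoint ecoef n e : R :=
  match n with
  | 0 => 2
  | n'.+1 => ecoef n' (shift_env e) / fine (mean (e 0%N).1) + moment_ratio (e 0%N)
  end.

Definition shiftn (T : Type) k (e : nat -> T) : nat -> T := fun i => e (i + k)%N.

Lemma shift_env_shiftn k e : shift_env (shiftn k e) = shiftn k.+1 e.
Proof. by apply: funext => i; rewrite /shift_env /shiftn addSnnS. Qed.

Lemma shiftn0 e : shiftn 0 e = e.
Proof. by apply: funext => i; rewrite /shiftn addn0. Qed.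

Lemma qnstep_ge0 n e x y : (forall i k, 0 <= (e i).1 k) -> (0 <= qnstep n e x y)%E.
Proof.
elim: n e x => [|n IH] e x h /=; first by rewrite lee_fin.
apply: nneseries_ge0 => k _ _; rewrite mule_ge0//; last by apply: IH => i j; exact: h.
by rewrite lee_fin qstep_ge0.
Qed.

(** The later bound is required only from states at least the current immigration, since smaller
    ones are unreachable. This is how a large immigration enters. *)
Lemma qnstep_step_le n e x y (u : nat -> R) (c : R) :
  (forall i, is_pmf (e i).1) -> (forall k, 0 <= u k) ->
  (forall k, ((e 0%N).2 <= k)%N -> (qnstep n (shift_env e) k y <= (u k)%:E)%E) ->
  (forall N, \sum_(k < N) qstep (e 0%N) x k * u k <= c) ->
  (qnstep n.+1 e x y <= c%:E)%E.
Proof.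
move=> he u0 hu hc /=.
have q0 k : 0 <= qstep (e 0%N) x k by apply: qstep_ge0; exact: (he 0%N).1.
apply: (@le_trans _ _ (\sum_(k <oo) (qstep (e 0%N) x k * u k)%:E)%E).
  apply: lee_nneseries => [k _ _|k _].
    rewrite mule_ge0 ?lee_fin//; apply: qnstep_ge0 => i j; exact: (he i.+1).1.
  have [Mk|kM] := leqP (e 0%N).2 k; last first.
    by rewrite /qstep leqNgt kM/= mul0r mul0e.
  by rewrite EFinM lee_wpmul2l ?lee_fin// hu.
by apply/partial_nneseries => // k; rewrite mulr_ge0.
Qed.

(** For an empty sum [pgf_le] reads [0 <= 1 - w^-1], where [w > 0] is the new coefficient; hence
    [1 <= w]. *)
Lemma ecoef_ge1 n e : (forall i, good (e i)) -> 1 <= ecoef n e.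
Proof.
elim: n e => [|n IH] e he /=; first lra.
have [p0 mu0 hmu hm2] := he 0%N.
have a1 : 1 <= ecoef n (shift_env e) by apply: IH => i; exact: he.
have m20 : 0 <= fine (second_moment (e 0%N).1).
  rewrite fine_ge0//; apply: nneseries_ge0 => k _ _.
  by rewrite lee_fin mulr_ge0 ?exprn_ge0//; exact: p0.1.
have := pgf_le p0 a1 mu0 hmu hm2 0; rewrite big_ord0 /moment_ratio.
set w := _ / _ + _; have w0 : 0 < w.
  apply: ltr_wpDr; first by rewrite divr_ge0// exprn_ge0// ltW.
  by rewrite divr_gt0// (lt_le_trans _ a1).
by rewrite subr_ge0 invf_le1.
Qed.

(** At time 0 the indicator of [x = y] is at most [2^y (1/2)^x], and [1/2 = 1 - 1/2] matches the
    initial coefficient 2. Each earlier generation replaces [1 - 1/a] by its image under the p.g.f.,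
    which [pgf_le] controls. *)
Lemma qnstep_le n e x y : (forall i, good (e i)) ->
  (qnstep n e x y <= (2 ^+ y * (1 - (ecoef n e)^-1) ^+ x)%:E)%E.
Proof.
elim: n e x => [|n IH] e x he.
  rewrite [qnstep _ _ _ _]/= [ecoef _ _]/= lee_fin; case: eqVneq => [->|_].
    by rewrite -exprMn (_ : 2 * _ = 1 :> R) ?expr1n//; field.
  by rewrite mulr_ge0 ?exprn_ge0//; lra.
have a1 : 1 <= ecoef n (shift_env e) by apply: ecoef_ge1 => i; exact: he.
have s0 : 0 <= 1 - (ecoef n (shift_env e))^-1.
  by rewrite subr_ge0 invf_le1// (lt_le_trans _ a1).
have s1 : 1 - (ecoef n (shift_env e))^-1 <= 1.
  by rewrite lerBlDr lerDl invr_ge0 (le_trans _ a1).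
have [p0 mu0 hmu hm2] := he 0%N.
apply: (@qnstep_step_le n e x y
  (fun k => 2 ^+ y * (1 - (ecoef n (shift_env e))^-1) ^+ k)).
- by move=> i; case: (he i).
- by move=> k; rewrite mulr_ge0 ?exprn_ge0.
- by move=> k _; apply: IH => i; exact: he.
- move=> N; under eq_bigr do rewrite mulrCA.
  rewrite -mulr_sumr ler_wpM2l ?exprn_ge0//=.
  apply: qstep_pgf_le; [exact: p0.1 | by rewrite s0 | exact: pgf_le].
Qed.

Lemma qnstep_uniform_step n e y (B : R) : 0 <= B -> (forall i, is_pmf (e i).1) ->
  (forall k, ((e 0%N).2 <= k)%N -> (qnstep n (shift_env e) k y <= B%:E)%E) ->
  forall x, (qnstep n.+1 e x y <= B%:E)%E.
Proof.
move=> B0 he h x; apply: (@qnstep_step_le n e x y (fun=> B)) => // N.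
rewrite -mulr_suml -[leRHS]mul1r ler_wpM2r//; exact: qstep_sum_le1.
Qed.

(** The [l] generations before the immigration are averaged out. After it the state is some
    [k' >= M], and [bernoulli_inv] gives [(1 - 1/a)^k' <= a/k' <= a/M]. *)
Lemma qnstep_immigration l n k e x y : (forall i, good (e i)) ->
  (0 < (e (k + l)%N).2)%N ->
  (qnstep (l + n.+1) (shiftn k e) x y <=
   (2 ^+ y * (ecoef n (shiftn (k + l).+1 e) / ((e (k + l)%N).2)%:R))%:E)%E.
Proof.
move=> he M0; set a := ecoef _ _; set B := _ * _.
have a1 : 1 <= a by apply: ecoef_ge1 => i; exact: he.
have a0 : 0 < a by rewrite (lt_le_trans _ a1).
have B0 : 0 <= B by rewrite mulr_ge0 ?exprn_ge0 ?divr_ge0// ltW.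
have hp k' i : is_pmf (shiftn k' e i).1 by case: (he (i + k')%N).
rewrite {}/B {}/a in a1 a0 B0 *; elim: l k x M0 a1 a0 B0 => [|l IH] k x.
  rewrite addn0 => M0 a1 a0 B0; apply: qnstep_uniform_step => // k' Mk'.
  rewrite shift_env_shiftn; apply: le_trans (qnstep_le _ _ _ _) _.
    by move=> i; exact: he.
  rewrite lee_fin ler_wpM2l ?exprn_ge0//.
  set a := ecoef _ _ in a1 a0 *.
  have k'0 : (0 < k')%N by exact: leq_trans Mk'.
  have h := @bernoulli_inv R a^-1 k'; rewrite invr_ge0 ltW//= invf_le1// in h.
  have {}h := h a1.
  have p0 : 0 <= (1 - a^-1) ^+ k' by rewrite exprn_ge0// subr_ge0 invf_le1.
  apply: (@le_trans _ _ (a / k'%:R)).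
    rewrite ler_pdivlMr ?ltr0n// -[leRHS]mulr1 -ler_pdivrMl// mulrC; apply: le_trans h.
    by rewrite -mulrA ler_wpM2l// lerDr.
  by apply: ler_wpM2l; [exact: ltW|rewrite lef_pV2 ?posrE ?ltr0n// ler_nat].
rewrite -addSnnS => M0 a1 a0 B0; rewrite addSn.
apply: qnstep_uniform_step => // k' _.
by rewrite shift_env_shiftn; apply: IH.
Qed.

Definition logmean v : R := ln (fine (mean v.1)).

(** Dividing by the mean of generation [j] turns [exp(S_(j+1) + A)] into [exp(S_j + A)]. Since
    [S_j >= -A], this exponential is at least 1, so each added [moment_ratio] is absorbed by raising
    the prefactor by [r]. *)
Lemma ecoef_bound n j e (A r : R) : (forall i, good (e i)) -> 0 <= r ->
  (forall i, (i <= j + n)%N -> `|\sum_(l < i) logmean (e l)| <= A) ->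
  (forall i, (i < j + n)%N -> moment_ratio (e i) <= r) ->
  ecoef n (shiftn j e) <= (2 + n%:R * r) * expR (\sum_(l < j) logmean (e l) + A).
Proof.
move=> he r0; elim: n j => [|n IH] j hA hr.
  rewrite /= mul0r addr0 ler_peMr// -expR0 ler_expR.
  by have := hA j (leq_addr _ _); rewrite ler_norml => /andP[]; lra.
have [_ mu0 _ _] := he j.
rewrite [ecoef _ _]/= shift_env_shiftn [shiftn j e 0%N]/=.
have {}IH : ecoef n (shiftn j.+1 e) <=
    (2 + n%:R * r) * expR (\sum_(l < j.+1) logmean (e l) + A).
  by apply: IH => i; rewrite addSnnS; [exact: hA|exact: hr].
apply: (@le_trans _ _ ((2 + n%:R * r) * expR (\sum_(l < j) logmean (e l) + A) + r)).
  apply: lerD; last by apply: hr; rewrite addnS ltnS leq_addr.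
  rewrite ler_pdivrMr//; apply: le_trans IH _.
  rewrite big_ord_recr/= -mulrA -[X in _ * (_ * X)](lnK mu0) -expRD/=.
  rewrite ler_wpM2l//; first by rewrite addr_ge0// mulr_ge0.
  by rewrite ler_expR /logmean; lra.
rewrite -natr1; set E := expR _; have : 1 <= E.
  rewrite -expR0 ler_expR.
  by have := hA j (leq_addr _ _); rewrite ler_norml => /andP[]; lra.
by move=> /(ler_wpM2l r0); lra.
Qed.

End Quenched2.

(** * Quenched first returns *)

Section Quenched3.
Variable R : realType.
Implicit Types (p : nat -> R) (v : envval R) (e : nat -> envval R).

Lemma qhitSS n e x t : qhit n.+2 e x t = (\sum_(k <oo)
  (((k != t)%:R * qstep (e 0%N) x k)%:E * qhit n.+1 (shift_env e) k t))%E.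
Proof. by []. Qed.

Lemma qhit_ge0 n e x y : (forall i k, 0 <= (e i).1 k) -> (0 <= qhit n e x y)%E.
Proof.
case: n => // n; elim: n e x => [|n IH] e x h; first by rewrite lee_fin qstep_ge0.
rewrite qhitSS; apply: nneseries_ge0 => k _ _; rewrite mule_ge0//.
  by rewrite lee_fin mulr_ge0// qstep_ge0.
by apply: IH => i j; exact: h.
Qed.

Lemma nneseries_delta_ge (u : nat -> R) t : (forall k, 0 <= u k) ->
  ((u t)%:E <= \sum_(k <oo) (u k * (k == t)%:R)%:E)%E.
Proof.
move=> u0; have u0' k : 0 <= u k * (k == t)%:R by rewrite mulr_ge0.
apply: (@le_trans _ _ (\sum_(0 <= k < t.+1) (u k * (k == t)%:R)%:E)%E); last first.
  by apply: nneseries_lim_ge => k _; rewrite lee_fin.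
by rewrite big_nat_recr//= eqxx mulr1 leeDr// sume_ge0// => k _; rewrite lee_fin.
Qed.

Lemma qhit_le_qnstep n e x t : (forall i, is_pmf (e i).1) ->
  (qhit n.+1 e x t <= qnstep n.+1 e x t)%E.
Proof.
elim: n e x => [|n IH] e x he.
  have q0 k : 0 <= qstep (e 0%N) x k by apply: qstep_ge0; exact: (he 0%N).1.
  exact: (nneseries_delta_ge t q0).
rewrite qhitSS; apply: lee_nneseries => [k _ _|k _].
  rewrite mule_ge0 ?lee_fin ?mulr_ge0// ?qstep_ge0//; first exact: (he 0%N).1.
  by apply: qhit_ge0 => i j; exact: (he i.+1).1.
have q0 : 0 <= qstep (e 0%N) x k by apply: qstep_ge0; exact: (he 0%N).1.
apply: lee_pmul.
- by rewrite lee_fin mulr_ge0.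
- by apply: qhit_ge0 => i j; exact: (he i.+1).1.
- by rewrite lee_fin ler_piMl// lern1 leq_b1.
- by apply: IH => i; exact: he.
Qed.

(** First-step decomposition: either the first step hits [t], or it leads to some [k != t] from
    which the induction hypothesis applies. The two masses add up to that of [qstep]. *)
Lemma qhit_sum_le1 N e x t : (forall i, is_pmf (e i).1) ->
  (\sum_(n < N) qhit n.+1 e x t <= 1)%E.
Proof.
elim: N e x => [|N IH] e x he; first by rewrite big_ord0.
have q0 k : 0 <= qstep (e 0%N) x k by apply: qstep_ge0; exact: (he 0%N).1.
have he' i j : 0 <= ((shift_env e) i).1 j by exact: (he i.+1).1.
rewrite big_ord_recl; under eq_bigr do rewrite lift0 qhitSS.
rewrite -nneseries_sum; last first.
  move=> n k _; rewrite mule_ge0 ?qhit_ge0// lee_fin mulr_ge0//.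
apply: (@le_trans _ _ (\sum_(k <oo) (qstep (e 0%N) x k * (k == t)%:R)%:E +
   \sum_(k <oo) ((k != t)%:R * qstep (e 0%N) x k)%:E)%E).
  apply: leeD; first exact: nneseries_delta_ge.
  apply: lee_nneseries => [k _ _|k _].
    by apply: sume_ge0 => n _; rewrite mule_ge0 ?qhit_ge0// lee_fin mulr_ge0.
  rewrite -ge0_sume_distrr//; last by move=> n _; exact: qhit_ge0.
  rewrite -[leRHS]mule1; apply: lee_wpmul2l; first by rewrite lee_fin mulr_ge0.
  by apply: IH => i; exact: he.
rewrite -nneseriesD; last 2 first.
- by move=> k _ _; rewrite lee_fin mulr_ge0.
- by move=> k _ _; rewrite lee_fin mulr_ge0.
rewrite (eq_eseriesr (g := fun k => (qstep (e 0%N) x k)%:E)).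
  by apply/partial_nneseries => // n; exact: qstep_sum_le1.
by move=> k _; rewrite -EFinD mulrC -mulrDl; case: eqP; rewrite ?addr0 ?add0r mul1r.
Qed.

Definition hit_prob x e := (\sum_(n <oo) qhit n.+1 e x x)%E.

Lemma hit_prob_le1 x e : (forall i, is_pmf (e i).1) -> (hit_prob x e <= 1)%E.
Proof.
move=> he; apply: lime_le.
  by apply: is_cvg_nneseries => k _ _; apply: qhit_ge0 => i j; exact: (he i).1.
by apply: nearW => N; rewrite big_mkord qhit_sum_le1.
Qed.

Lemma hit_prob_ge0 x e : (forall i, is_pmf (e i).1) -> (0 <= hit_prob x e)%E.
Proof.
move=> he; apply: nneseries_ge0 => k _ _; apply: qhit_ge0 => i j; exact: (he i).1.
Qed.

(** With [A = (m+3) D], the coefficient is at most [2^(m+4) exp(D + 2A)], while the immigration at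
    [j] exceeds [exp(4A)]. The surplus pays for [2^x] and for [2 N (N+1)], a form chosen so that the
    sum over [N] telescopes. *)
Lemma qnstep_scale_bound e x m (D : R) j k N : (forall i, good (e i)) ->
  (x + 10)%:R <= D ->
  (forall i, (i <= 2 ^ (m + 2))%N -> `|\sum_(l < i) logmean (e l)| <= m.+3%:R * D) ->
  (forall i, (i < 2 ^ (m + 2))%N -> moment_ratio (e i) <= 2 * expR D) ->
  4 * m.+3%:R * D < ln ((e j).2)%:R ->
  (k <= j < N)%N -> (N <= 2 ^ (m + 2))%N ->
  (qnstep (N - k) (shiftn k e) x x <= ((2 * N%:R * N.+1%:R)^-1)%:E)%E.
Proof.
move=> he xD hS hr hM /andP[kj jN] N2.
set A := m.+3%:R * D in hS.
have D0 : 0 <= D by apply: le_trans xD.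
have DA : D <= A by rewrite /A ler_peMl// ler1n.
have A0 : 0 <= A by apply: le_trans DA.
have M0 : (0 < (e j).2)%N.
  rewrite lt0n; apply/eqP => M0; move: hM; rewrite M0 ln0//.
  by rewrite ltNge -mulrA -/A mulr_ge0.
have MA : expR (4 * A) <= (e j).2%:R.
  by rewrite -[leRHS]lnK ?posrE ?ltr0n// ler_expR mulrA ltW.
have [l hl] : exists l, (k + l = j)%N by exists (j - k)%N; rewrite subnKC.
have [n hn] : exists n, (j + n.+1 = N)%N.
  by exists (N - j.+1)%N; rewrite addnS -addSn subnKC.
have -> : (N - k = l + n.+1)%N by lia.
have Mj : (0 < (e (k + l)%N).2)%N by rewrite hl.
apply: le_trans (qnstep_immigration n x x he Mj) _; rewrite hl lee_fin.
have E : ecoef n (shiftn j.+1 e) <= 2 ^+ (m + 4) * expR D * expR (2 * A).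
  have jn : (j.+1 + n = N)%N by lia.
  apply: (le_trans (@ecoef_bound R n j.+1 e A (2 * expR D) he _ _ _)).
  - by rewrite mulr_ge0// expR_ge0.
  - by move=> i; rewrite jn => iN; apply: hS; exact: leq_trans N2.
  - by move=> i; rewrite jn => iN; apply: hr; exact: leq_trans N2.
  apply: ler_pM.
  - by rewrite addr_ge0// mulr_ge0// mulr_ge0// expR_ge0.
  - exact: expR_ge0.
  - have nb : n%:R <= 2 ^+ (m + 2) :> R by rewrite -natrX ler_nat; lia.
    have e1 : 1 <= expR D by rewrite -expR0 ler_expR.
    have p1 : 1 <= 2 ^+ (m + 2) :> R by rewrite exprn_ege1//; lra.
    rewrite (_ : (m + 4 = m + 2 + 2)%N); last by rewrite -addnA.
    rewrite (exprD _ (m + 2) 2); set P := 2 ^+ (m + 2) in nb p1 *; nra.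
  - rewrite ler_expR; have := hS j.+1; rewrite -jn in N2.
    have jle : (j.+1 <= 2 ^ (m + 2))%N by lia.
    by move=> /(_ jle); rewrite ler_norml => /andP[]; lra.
(* One factor [exp(A)] covers all powers of 2, because [x + (m+4) + (2m+6) <= (m+3)(x+10)]. Another
   covers [exp(D)]. *)
have hA : 2 ^+ (m.+3 * (x + 10)) <= expR A.
  have e2 : 2 <= expR 1 :> R by have := @expR_ge1Dx R 1; lra.
  apply: (@le_trans _ _ (expR ((m.+3 * (x + 10))%:R))).
    rewrite -[(_ * (x + 10))%:R]mulr1 expRM_natl; apply: lerXn2r => //; rewrite nnegrE ?expR_ge0//.
  by rewrite ler_expR natrM /A ler_wpM2l.
have N0 : 0 < 2 * N%:R * N.+1%:R :> R.
  by rewrite !mulr_gt0// ltr0n; lia.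
have Nb : 2 * N%:R * N.+1%:R <= 2 ^+ (2 * m + 6) :> R.
  rewrite -!natrM -natrX ler_nat (_ : (2 * m + 6 = (m + 2) + (m + 2) + 2)%N); last lia.
  rewrite (expnD 2 _ 2) (expnD 2 (m + 2)).
  have := leq_mul N2 N2; have : (0 < N)%N by lia.
  set P := (2 ^ (m + 2))%N; nia.
rewrite -[leRHS]mul1r ler_pdivlMr// mulrA mulrAC ler_pdivrMr ?ltr0n// mul1r.
apply: le_trans MA.
apply: (@le_trans _ _ (2 ^+ x * (2 ^+ (m + 4) * expR D * expR (2 * A)) *
    2 ^+ (2 * m + 6))).
  apply: ler_pM.
  - by rewrite mulr_ge0 ?exprn_ge0// (le_trans _ (ecoef_ge1 _ _))// => i; exact: he.
  - exact: ltW.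
  - by rewrite ler_wpM2l// exprn_ge0.
  - exact: Nb.
rewrite (_ : _ * _ * _ = 2 ^+ (x + (m + 4) + (2 * m + 6)) * expR D * expR (2 * A)).
  rewrite (_ : 4 * A = A + A + 2 * A); last by ring.
  rewrite (expRD (A + A)) ler_wpM2r ?expR_ge0// expRD.
  apply: ler_pM => //; rewrite ?exprn_ge0 ?expR_ge0 ?ler_expR//.
  by apply: le_trans hA; rewrite ler_weXn2l//; [lra|nia].
by rewrite !exprD; ring.
Qed.

Lemma sum_inv_consecutive L :
  \sum_(n < L) ((n.+1%:R * n.+2%:R)^-1 : R) = 1 - L.+1%:R^-1.
Proof.
elim: L => [|L IH]; first by rewrite big_ord0 invr1 subrr.
rewrite big_ord_recr/= IH -(natr1 L.+1) -(natr1 L).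
have : 0 <= L%:R :> R by []; move: (L%:R) => n n0; field.
by apply/andP; split; rewrite gt_eqF//; lra.
Qed.

(** The start [k] is the large immigration of scale [m0]. Every later time [N] is separated from [k]
    by a large immigration of a scale suited to [N], so the returns sum to at most [1/2]. *)
Lemma hit_prob_le_half e x (D : nat -> R) m0 : (forall i, good (e i)) ->
  (forall m, (m0 <= m)%N -> [/\ (x + 10)%:R <= D m,
   (forall i, (i <= 2 ^ (m + 2))%N -> `|\sum_(l < i) logmean (e l)| <= m.+3%:R * D m),
   (forall i, (i < 2 ^ (m + 2))%N -> moment_ratio (e i) <= 2 * expR (D m)) &
   exists2 j, (2 ^ m <= j < 2 ^ m.+1)%N & 4 * m.+3%:R * D m < ln ((e j).2)%:R]) ->
  exists k, (hit_prob x (shiftn k e) <= (2^-1)%:E)%E.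
Proof.
move=> he h.
have [_ _ _ [k /andP[mk km] hk]] := h m0 (leqnn _).
exists k.
have step n : (qhit n.+1 (shiftn k e) x x <= (2^-1 * (n.+1%:R * n.+2%:R)^-1)%:E)%E.
  apply: (le_trans (qhit_le_qnstep _ _ _ _)) => [i|]; first by case: (he (i + k)%N).
  pose N := (k + n.+1)%N.
  have -> : (n.+1 = N - k)%N by rewrite /N addKn.
  (* The scale attached to [N] is the least [m >= m0] with [N <= 2^(m+2)]. *)
  have ex : exists m, (m0 <= m)%N && (N <= 2 ^ (m + 2))%N.
    exists (maxn m0 N); rewrite leq_maxl/= (leq_trans (ltnW (ltn_expl N (isT : 1 < 2)%N)))//.
    by rewrite leq_exp2l// (leq_trans (leq_maxr m0 N))// leq_addr.
  case: (ex_minnP ex) => m /andP[m0m Nm] min.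
  (* If [m = m0], take [j = k]. Otherwise minimality forces [N > 2^(m+1)], so the immigration of
     scale [m] comes before [N], and it comes after [k < 2^(m0+1) <= 2^m]. *)
  have [j kj jm] : exists2 j, (k <= j < N)%N & 4 * m.+3%:R * D m < ln ((e j).2)%:R.
    move: m0m; rewrite leq_eqVlt => /orP[/eqP mm0|m0m].
      by exists k; rewrite -?mm0// leqnn/= /N; lia.
    have [_ _ _ [j /andP[mj jm] hj]] := h m (ltnW m0m).
    exists j => //; apply/andP; split.
      apply: (leq_trans (ltnW km)); apply: leq_trans mj.
      by rewrite leq_exp2l.
    apply: (leq_trans jm); rewrite leqNgt; apply/negP => Nlt.
    have := min m.-1; rewrite (_ : (m0 <= m.-1)%N)/=; last by lia.
    have -> : (m.-1 + 2 = m.+1)%N by lia.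
    by move=> /(_ (ltnW Nlt)); lia.
  have [h1 h2 h3 _] := h m m0m.
  apply: (le_trans (qnstep_scale_bound he h1 h2 h3 jm kj Nm)).
  rewrite lee_fin -invfM -mulrA lef_pV2 ?posrE; last 2 first.
  - by rewrite !mulr_gt0// ltr0n /N; lia.
  - by rewrite !mulr_gt0// ltr0n /N; lia.
  rewrite ler_wpM2l//; apply: ler_pM => //; rewrite ler_nat /N; lia.
apply: (@le_trans _ _ (\sum_(n <oo) (2^-1 * (n.+1%:R * n.+2%:R)^-1)%:E)%E).
  apply: lee_nneseries => [n _ _|n _]; last exact: step.
  by apply: qhit_ge0 => i l; case: (he (i + k)%N) => -[].
apply/partial_nneseries => [n|L]; first by rewrite mulr_ge0// invr_ge0 mulr_ge0.
rewrite -mulr_sumr sum_inv_consecutive ler_piMr// lerBlDr lerDl invr_ge0.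
Qed.

End Quenched3.

(** * Integrals and laws *)

Section General.
Context (d : measure_display) (T : measurableType d) (R : realType).
Local Open Scope ereal_scope.

(** The integral of a nonnegative function is a supremum over the simple functions below it, so
    monotonicity covers arbitrary nonnegative functions, such as the moments in the hypotheses. *)
Lemma le_integral_of_ge0 (mu : {measure set T -> \bar R}) (f g : T -> \bar R) :
  (forall x, 0 <= f x) -> (forall x, f x <= g x) ->
  \int[mu]_x f x <= \int[mu]_x g x.
Proof.
move=> f0 fg; have g0 x : 0 <= g x by apply: le_trans (fg x).
rewrite !ge0_integralTE//; apply: le_ereal_sup => _ /= [h hf <-].
by exists h => // x; exact: le_trans (fg x).
Qed.

Lemma integral_same_law (d' : measure_display) (T' : measurableType d')
    (mu : {measure set T -> \bar R}) (phi psi : {mfun T >-> T'}) (f : T' -> \bar R) :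
  measurable_fun setT f ->
  (forall B, measurable B -> mu (phi @^-1` B) = mu (psi @^-1` B)) ->
  \int[mu]_x f (phi x) = \int[mu]_x f (psi x).
Proof.
move=> mf same.
have pos (g : T' -> \bar R) : measurable_fun setT g -> (forall x, 0 <= g x) ->
    \int[mu]_x g (phi x) = \int[mu]_x g (psi x).
  move=> mg g0.
  have := @ge0_integral_pushforward _ _ _ _ R phi (measurable_funPT phi) mu setT g
    measurableT mg (fun x _ => g0 x).
  have := @ge0_integral_pushforward _ _ _ _ R psi (measurable_funPT psi) mu setT g
    measurableT mg (fun x _ => g0 x).
  rewrite !preimage_setT => <- <-.
  by apply: eq_measure_integral => A mA _; exact: same.
rewrite integralE [RHS]integralE; congr (_ - _).
  under eq_integral do rewrite funepos_comp/=.
  under [RHS]eq_integral do rewrite funepos_comp/=.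
  by apply: pos => //; exact: measurable_funepos.
under eq_integral do rewrite funeneg_comp/=.
under [RHS]eq_integral do rewrite funeneg_comp/=.
by apply: pos => //; exact: measurable_funeneg.
Qed.

(** By independence the joint law of [(U, V)] is the product of the marginals. Fubini then leaves
    the inner integral [x * E[V] = 0]. *)
Lemma integral_indep_mul_eq0 (mu : probability T R) (U V : {mfun T >-> R}) :
  (forall A B, measurable A -> measurable B ->
    mu (U @^-1` A `&` V @^-1` B) = mu (U @^-1` A) * mu (V @^-1` B)) ->
  mu.-integrable setT (fun x => (V x)%:E) ->
  mu.-integrable setT (fun x => (U x * V x)%:E) ->
  \int[mu]_x (V x)%:E = 0 ->
  \int[mu]_x (U x * V x)%:E = 0.
Proof.
move=> ind iV iUV V0.
pose UV x := (U x, V x).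
have mUV : measurable_fun setT UV.
  by apply: measurable_fun_pair; exact: measurable_funPT.
pose UV' : {mfun T >-> (R * R)%type} := HB.pack UV (isMeasurableFun.Build _ _ _ _ _ mUV).
pose m := distribution mu UV'.
pose m1 := distribution mu U; pose m2 := distribution mu V.
have mE X : measurable X -> (m1 \x m2) X = m X.
  apply: product_measure_unique => A B mA mB /=.
  by rewrite /m1 /m2 /m /distribution /pushforward -ind//; congr (mu _).
have intE (f : R * R -> \bar R) : \int[m1 \x m2]_z f z = \int[m]_z f z.
  by apply: eq_measure_integral => A mA _; exact: mE.
have mf : measurable_fun [set: R * R] (fun z : R * R => (z.1 * z.2)%:E).
  by apply/measurable_EFinP; apply: measurable_funM.
have im : m.-integrable setT (fun z : R * R => (z.1 * z.2)%:E).
  exact: (@integrable_pushforward _ _ _ _ R UV' mUV mu setT _ mf iUV).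
have im12 : (m1 \x m2).-integrable setT (fun z : R * R => (z.1 * z.2)%:E).
  apply/integrableP; split => //; have /integrableP[_] := im.
  by rewrite intE.
transitivity (\int[m]_z (z.1 * z.2)%:E).
  by rewrite (@integral_distribution _ _ _ _ _ mu UV' _ mf).
rewrite -intE -integral12_prod_meas1//.
apply: integral0_eq => x _; rewrite /fubini_F.
have V0' : \int[m2]_y y%:E = 0.
  rewrite (@integral_distribution _ _ _ _ _ mu V (fun y => y%:E))//.
  exact/measurable_EFinP.
under eq_integral do rewrite EFinM.
rewrite integralZl//; first by rewrite V0' mule0.
have mE' : measurable_fun [set: R] (fun y : R => y%:E) by exact/measurable_EFinP.
exact: (@integrable_pushforward _ _ _ _ R V (measurable_funPT V) mu setT _ mE' iV).
Qed.
End General.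

(** * Measurability and stationarity of the environment *)

Section EnvMeasurability.
Variable R : realType.

Definition envT : measurableType _ := g_sigma_algebraType (@env_gen R).

Lemma measurable_offspring k : measurable_fun [set: envT] (fun v : envT => v.1 k).
Proof.
move=> _ B mB; rewrite setTI; apply: sub_sigma_algebra; left.
by exists k, B.
Qed.

Lemma measurable_immigrants (P : set nat) : measurable [set v : envT | P v.2].
Proof.
rewrite (_ : [set _ | _] = \bigcup_(m in P) [set v : envT | v.2 = m]).
  apply: bigcup_measurable => m _; apply: sub_sigma_algebra; right.
  by exists m.
apply/seteqP; split => [v /= Pv|v /= [m Pm /= ->]//].
by exists v.2.
Qed.

(* Points of [envT] may carry negative weights; taking absolute values makes the
   series of nonnegative functions measurable on the whole space. *)
Definition absenv (v : envval R) : envval R := (fun k => `|v.1 k|, v.2).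

Lemma absenv_id v : (forall k, 0 <= v.1 k) -> absenv v = v.
Proof.
case: v => p m h; rewrite /absenv /=; congr pair.
by apply: funext => k; rewrite ger0_norm// h.
Qed.

Lemma measurable_absoffspring k :
  measurable_fun [set: envT] (fun v : envT => `|v.1 k|).
Proof. by apply: measurableT_comp => //; exact: measurable_offspring. Qed.

Lemma measurable_mean : measurable_fun [set: envT] (fun v : envT => mean (absenv v).1).
Proof.
apply: (ge0_emeasurable_sum (P := xpredT)) => [k v _ _|k _].
  by rewrite lee_fin mulr_ge0 /=.
by apply/measurable_EFinP; apply: measurable_funM => //; exact: measurable_absoffspring.
Qed.

Lemma measurable_second_moment :
  measurable_fun [set: envT] (fun v : envT => second_moment (absenv v).1).
Proof.
apply: (ge0_emeasurable_sum (P := xpredT)) => [k v _ _|k _].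
  by rewrite lee_fin mulr_ge0 ?exprn_ge0 /=.
by apply/measurable_EFinP; apply: measurable_funM => //; exact: measurable_absoffspring.
Qed.

Lemma measurable_convn x y :
  measurable_fun [set: envT] (fun v : envT => convn (absenv v).1 x y).
Proof.
elim: x y => [|x IH] y /=; first exact: measurable_cst.
apply: measurable_sum => i; apply: measurable_funM; first exact: IH.
exact: measurable_absoffspring.
Qed.

Lemma measurable_qstep x y :
  measurable_fun [set: envT] (fun v : envT => qstep (absenv v) x y).
Proof.
rewrite (_ : (fun _ => _) = (fun v : envT => \sum_(m < y.+1)
   \1_[set v : envT | v.2 = m] v * convn (absenv v).1 x (y - m))).
  apply: measurable_sum => i; apply: measurable_funM; last exact: measurable_convn.
  by apply: measurable_indic; exact: (measurable_immigrants [set val i]).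
apply: funext => v; rewrite /qstep; case: ifPn => [vy|vy] /=.
  rewrite (bigD1 (inord v.2))//= inordK// indicE mem_set//= mul1r.
  rewrite big1 ?addr0// => i ne; rewrite indicE memNset ?mul0r//= => vi.
  by move: ne; rewrite vi inord_val eqxx.
rewrite big1// => i _; rewrite indicE memNset ?mul0r//= => vi.
by move: vy; rewrite /= vi -ltnS ltn_ord.
Qed.

(** The product sigma-algebra on sequences is presented by cylinders over initial segments, since
    these are closed under intersection and so determine a probability. *)
Definition env_cylinder : set (set (nat -> envval R)) := [set A | exists n B,
  (forall i, env_meas (B i)) /\ A = [set e | forall i, (i < n)%N -> B i (e i)]].

Definition envseqT : measurableType _ := g_sigma_algebraType env_cylinder.

Lemma measurable_coordinate i :
  measurable_fun [set: envseqT] (fun e : envseqT => e i : envT).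
Proof.
move=> _ B mB; rewrite setTI; apply: sub_sigma_algebra.
exists i.+1, (fun j => if j == i then B else setT); split.
  by move=> j; case: ifP => // _; exact: (@measurableT _ envT).
apply/seteqP; split => [e /= eB j _|e /= h].
  by case: ifP => // /eqP ->.
by have := h i (ltnSn i); rewrite eqxx.
Qed.

Lemma measurable_to_envseq (d : measure_display) (T : measurableType d)
    (f : T -> envseqT) :
  (forall i, measurable_fun [set: T] (fun x => f x i : envT)) ->
  measurable_fun [set: T] f.
Proof.
move=> mf; have := @measurability _ _ T envseqT setT f env_cylinder; apply => // _
  [_ [n [B [mB ->]]] <-].
rewrite setTI (_ : _ @^-1` _ = \bigcap_(i in `I_n) ((fun x => f x i) @^-1` B i)).
  apply: fin_bigcap_measurable => // i _; rewrite -[X in measurable X]setTI.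
  by apply: mf => //; exact: mB.
by apply/seteqP; split => [x /= h i /= ?|x /= h i ?]; exact: h.
Qed.

Lemma measurable_shift :
  measurable_fun [set: envseqT] (fun e : envseqT => shift_env e : envseqT).
Proof. by apply: measurable_to_envseq => i; exact: measurable_coordinate. Qed.

Lemma measurable_qhit n x t : measurable_fun [set: envseqT]
  (fun e : envseqT => qhit n (fun i => absenv (e i)) x t).
Proof.
case: n => [|n]; first exact: measurable_cst.
elim: n x => [|n IH] x.
  apply/measurable_EFinP.
  exact: (measurableT_comp (measurable_qstep x t) (measurable_coordinate 0%N)).
pose h k (e : envseqT) := (((k != t)%:R * qstep (absenv (e 0%N)) x k)%:E *
  qhit n.+1 (fun i => absenv (shift_env e i)) k t)%E.
apply: (ge0_emeasurable_sum (h := h) (P := xpredT)) => [k e _ _|k _].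
  apply: mule_ge0; last by apply: qhit_ge0 => i j; exact: normr_ge0.
  by rewrite lee_fin mulr_ge0//; apply: qstep_ge0 => j; exact: normr_ge0.
apply: emeasurable_funM.
  apply/measurable_EFinP; apply: measurable_funM => //.
  exact: (measurableT_comp (measurable_qstep x k) (measurable_coordinate 0%N)).
exact: (measurableT_comp (IH k) measurable_shift).
Qed.

Lemma measurable_hit_prob x : measurable_fun [set: envseqT]
  (fun e : envseqT => hit_prob x (fun i => absenv (e i))).
Proof.
apply: (ge0_emeasurable_sum (P := xpredT)) => [k e _ _|k _].
  by apply: qhit_ge0 => i j; exact: normr_ge0.
exact: measurable_qhit.
Qed.

End EnvMeasurability.

Section Stationarity.
Context (R : realType) (d : measure_display) (Omega : measurableType d)
  (Q : probability Omega R) (env : nat -> Omega -> envval R).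
Hypothesis menv : forall i B, env_meas B -> measurable (env i @^-1` B).
Hypothesis iid : env_iid Q env.

Lemma measurable_env i : measurable_fun [set: Omega] (env i : Omega -> envT R).
Proof. by move=> _ B mB; rewrite setTI; exact: menv. Qed.

Lemma measurable_shifted_envseq k : measurable_fun [set: Omega]
  (fun w => shiftn k (envseq env w) : envseqT R).
Proof. by apply: measurable_to_envseq => i; exact: measurable_env. Qed.

Lemma envseq_cylinder_prob k n (B : nat -> set (envval R)) :
  (forall i, env_meas (B i)) ->
  Q [set w | forall i, (i < n)%N -> B i (env (i + k)%N w)] =
  (\prod_(i < n) Q (env 0%N @^-1` B i))%E.
Proof.
move=> mB; have [same ind] := iid.
have := ind (iota k n) (fun i => B (i - k)%N) (iota_uniq _ _) (fun i => mB _).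
rewrite (_ : \bigcap_(i in _) _ = [set w | forall i, (i < n)%N -> B i (env (i + k)%N w)]).
  move=> ->; rewrite -{1}(addn0 k) iotaDl big_map -{1}(subn0 n) -/(index_iota 0 n) big_mkord.
  by apply: eq_bigr => i _; rewrite addKn same.
apply/seteqP; split => [w /= h i ni|w /= h i /=].
  have := h (i + k)%N; rewrite /= mem_iota addnC leq_addr ltn_add2l ni addKn.
  exact.
rewrite mem_iota => /andP[ki ik]; have := h (i - k)%N; rewrite subnK//; apply.
by rewrite ltn_subLR.
Qed.

(** The laws of the shifted and the unshifted sequence agree on cylinders, where
    [envseq_cylinder_prob] gives a product free of [k]; uniqueness of measures on a pi-system
    extends this to all measurable sets. *)
Lemma envseq_stationary k (A : set (envseqT R)) : measurable A ->
  Q ((fun w => shiftn k (envseq env w)) @^-1` A) = Q (envseq env @^-1` A).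
Proof.
move=> mA.
pose f k : {mfun Omega >-> envseqT R} := HB.pack (fun w => shiftn k (envseq env w) : envseqT R)
   (isMeasurableFun.Build _ _ _ _ _ (measurable_shifted_envseq k)).
have E0 : envseq env = (fun w => shiftn 0 (envseq env w)).
  by apply: funext => w; rewrite shiftn0.
have IG : setI_closed (@env_cylinder R).
  move=> _ _ [n1 [B1 [mB1 ->]]] [n2 [B2 [mB2 ->]]].
  exists (maxn n1 n2), (fun i => (if (i < n1)%N then B1 i else setT) `&`
     (if (i < n2)%N then B2 i else setT)); split.
    move=> i; apply: (@measurableI _ (envT R)); case: ifP => _.
    - exact: mB1.
    - exact: (@measurableT _ (envT R)).
    - exact: mB2.
    - exact: (@measurableT _ (envT R)).
  apply/seteqP; split => [e /= [h1 h2] i _|e /= h].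
    by split; case: ifP => // ?; [exact: h1|exact: h2].
  split=> i ni.
    by have [] := h i (leq_trans ni (leq_maxl _ _)); rewrite ni.
  by have [] := h i (leq_trans ni (leq_maxr _ _)); rewrite ni.
have GT (_ : nat) : @env_cylinder R setT.
  exists 0%N, (fun=> setT); split; last by apply/seteqP; split.
  by move=> i; exact: (@measurableT _ (envT R)).
have cov : \bigcup_(_ : nat) [set: nat -> envval R] = setT.
  by apply/seteqP; split => // e _; exists 0%N.
have eqG B : @env_cylinder R B -> distribution Q (f k) B = distribution Q (f 0%N) B.
  move=> [n [C [mC ->]]]; rewrite /distribution /pushforward.
  exact: etrans (envseq_cylinder_prob k n mC) (esym (envseq_cylinder_prob 0 n mC)).
have fin (_ : nat) : (distribution Q (f k) setT < +oo)%E.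
  exact: (le_lt_trans (probability_le1 _ _) (ltry _)).
rewrite [in RHS]E0; exact: (@measure_unique _ R (envseqT R) (@env_cylinder R) (fun=> setT)
  erefl IG GT cov (distribution Q (f k)) (distribution Q (f 0%N)) eqG fin A mA).
Qed.

End Stationarity.

(** * Dyadic scales *)

Section Numeric.
Variable R : realType.

(** By binary expansion [[0, n]] is a union of dyadic blocks with at most one of each size [2^l],
    [l <= m]; hence the factor [m + 1]. The induction on [l] treats all block starts [b * 2^l] at
    once. *)
Lemma dyadic_chaining (S : nat -> R) (D : R) m : 0 <= D ->
  (forall l b, (l <= m)%N -> (b < 2 ^ (m - l))%N ->
    `|S (b.+1 * 2 ^ l)%N - S (b * 2 ^ l)%N| <= D) ->
  forall n, (n <= 2 ^ m)%N -> `|S n - S 0%N| <= m.+1%:R * D.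
Proof.
move=> D0 h.
have H l : (l <= m)%N -> forall b n, (b < 2 ^ (m - l))%N -> (n <= 2 ^ l)%N ->
    `|S (b * 2 ^ l + n)%N - S (b * 2 ^ l)%N| <= l.+1%:R * D.
  elim: l => [|l IH] lm b n bm nl.
    case: n nl => [|[|//]] _; first by rewrite addn0 subrr normr0 mulr_ge0.
    have := h 0%N b lm bm; rewrite expn0 !muln1 addn1 mul1r; exact.
  have lm' := ltnW lm.
  have e2 : (2 ^ (m - l) = 2 * 2 ^ (m - l.+1))%N.
    by rewrite -expnS; congr (2 ^ _)%N; lia.
  have -> : (b * 2 ^ l.+1 = (2 * b) * 2 ^ l)%N by rewrite expnS; lia.
  have D1 : l.+2%:R * D = l.+1%:R * D + D by rewrite -natr1 mulrDl mul1r.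
  have [nl'|nl'] := leqP n (2 ^ l).
    apply: le_trans (IH lm' (2 * b)%N n _ nl') _; first by rewrite e2; lia.
    by rewrite D1 lerDl.
  have nE : (2 * b * 2 ^ l + n = (2 * b).+1 * 2 ^ l + (n - 2 ^ l))%N.
    by rewrite mulSn; lia.
  rewrite nE D1; apply: le_trans (ler_distD (S ((2 * b).+1 * 2 ^ l)%N) _ _) _.
  apply: lerD.
    by apply: IH => //; [rewrite e2; lia|rewrite expnS in nl; lia].
  by apply: h => //; rewrite e2; lia.
move=> n nm; have := H m (leqnn m) 0%N n; rewrite mul0n add0n subnn; exact.
Qed.

Lemma expr_ge1D (a : R) m : 1 <= a -> 1 + m%:R * (a - 1) <= a ^+ m.
Proof.
move=> a1; elim: m => [|m IH]; first by rewrite mul0r addr0 expr0.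
rewrite exprS; apply: le_trans (ler_wpM2l _ IH); last by lra.
rewrite -natr1; have : 0 <= m%:R * (a - 1) ^+ 2 by rewrite mulr_ge0 ?sqr_ge0.
nra.
Qed.

Lemma expr_eventually_ge (a c : R) : 1 < a ->
  exists m0, forall m, (m0 <= m)%N -> c <= a ^+ m.
Proof.
move=> a1; exists (Num.truncn (c / (a - 1))).+1 => m mm.
apply: le_trans (expr_ge1D m (ltW a1)).
have a0 : 0 < a - 1 by lra.
have : c / (a - 1) <= m%:R.
  by apply: (le_trans (ltW (truncnS_gt _))); rewrite ler_nat.
rewrite ler_pdivrMr//; lra.
Qed.

Lemma expr_lin_bound (k : R) m : 0 <= k < 1 -> m.+1%:R * k ^+ m <= (1 - k)^-1.
Proof.
move=> /andP[k0 k1].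
have := @bernoulli_inv R (1 - k) m; rewrite subKr.
have -> : 0 <= 1 - k <= 1 by apply/andP; split; lra.
move=> /(_ isT) h; rewrite -[leRHS]mul1r ler_pdivlMr; last by lra.
apply: le_trans h; rewrite -mulrA mulrCA ler_wpM2l ?exprn_ge0//.
by rewrite -natr1 mulrDl mul1r; lra.
Qed.

Lemma geometric_sum_le (k : R) N : 0 <= k < 1 -> \sum_(i < N) k ^+ i <= (1 - k)^-1.
Proof.
move=> /andP[k0 k1]; rewrite -[leRHS]mul1r ler_pdivlMr; last by lra.
have -> : (\sum_(i < N) k ^+ i) * (1 - k) = 1 - k ^+ N.
  elim: N => [|N IH]; first by rewrite big_ord0 mul0r expr0 subrr.
  by rewrite big_ord_recr/= mulrDl IH exprSr; ring.
by rewrite lerBlDr lerDl exprn_ge0.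
Qed.

(** Write [t = k^4] and [s = k^2]. Then [t^m = (k^m)^2 s^m], where [(m+3) k^m] is bounded by
    [expr_lin_bound] and [s^m] is summable. *)
Lemma quadratic_geometric_series (t : R) : 0 <= t < 1 ->
  (\sum_(m <oo) (m.+3%:R ^+ 2 * t ^+ m)%:E < +oo)%E.
Proof.
move=> /andP[t0 t1].
pose s := Num.sqrt t; pose k := Num.sqrt s.
have s0 : 0 <= s by exact: sqrtr_ge0.
have k0 : 0 <= k by exact: sqrtr_ge0.
have st : s ^+ 2 = t by rewrite sqr_sqrtr.
have ks : k ^+ 2 = s by rewrite sqr_sqrtr.
have s1 : s < 1 by rewrite ltNge; apply/negP => s1; nra.
have k1 : k < 1 by rewrite ltNge; apply/negP => k1; nra.
have kb : 0 <= k < 1 by rewrite k0.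
have sb : 0 <= s < 1 by rewrite s0.
pose C := 9 * ((1 - k)^-1) ^+ 2.
have C0 : 0 <= C by rewrite mulr_ge0// sqr_ge0.
apply: (@le_lt_trans _ _ (C * (1 - s)^-1)%:E); last exact: ltry.
apply/partial_nneseries => [m|N]; first by rewrite mulr_ge0 ?exprn_ge0.
apply: (@le_trans _ _ (\sum_(i < N) C * s ^+ i)); last first.
  by rewrite -mulr_sumr ler_wpM2l// geometric_sum_le.
apply: ler_sum => m _.
have -> : t ^+ m = (k ^+ m) ^+ 2 * s ^+ m.
  by rewrite -st -ks -!exprM -exprD; congr (_ ^+ _); lia.
rewrite mulrA ler_wpM2r ?exprn_ge0// -exprMn.
have -> : C = (3 * (1 - k)^-1) ^+ 2 by rewrite /C exprMn; ring.
apply: lerXn2r; rewrite ?nnegrE ?mulr_ge0 ?exprn_ge0// ?invr_ge0; first lra.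
apply: (@le_trans _ _ (3 * (m.+1%:R * k ^+ m))).
  by rewrite mulrA ler_wpM2r ?exprn_ge0// -natrM ler_nat; lia.
by rewrite ler_wpM2l//; exact: expr_lin_bound.
Qed.

(* [rho = 2^beta] with [1/2 < beta < 1/lambda]: the scale [rho^m] lies between
   the fluctuations of the walk and the largest immigration up to time [2^m]. *)
Lemma scale_exists (lambda : R) : 0 < lambda < 2 ->
  exists rho : R, [/\ 1 < rho, 2 / rho ^+ 2 < 1 & rho `^ lambda / 2 < 1].
Proof.
move=> /andP[l0 l2]; pose b := (2^-1 + lambda^-1) / 2.
have l1 : 2^-1 < lambda^-1 by rewrite ltf_pV2 ?posrE.
have b2 : 2^-1 < b by rewrite /b; lra.
have mono x y : x < y -> (2 : R) `^ x < 2 `^ y.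
  by move=> xy; rewrite /powR; case: eqP => [|_]; [lra|rewrite ltr_expR ltr_pM2r// ln_gt0; lra].
have p21 : (2 : R) `^ 1 = 2 by rewrite powRr1.
exists (2 `^ b); split.
- by rewrite -[ltLHS](powRr0 2); apply: mono; lra.
- have g : 0 < 2 `^ b :> R by rewrite powR_gt0.
  rewrite ltr_pdivrMr ?exprn_gt0// mul1r -powR_mulrn ?ltW// -powRrM -[ltLHS]p21.
  by apply: mono; lra.
- rewrite ltr_pdivrMr// mul1r -powRrM -[ltRHS]p21; apply: mono.
  rewrite /b mulrAC mulrDl mulVf ?gt_eqF//; lra.
Qed.

End Numeric.

(** * Deviation bounds *)

Section ProbabilityBounds.
Context (R : realType) (d : measure_display) (Omega : measurableType d)
  (Q : probability Omega R).
Local Open Scope ereal_scope.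

(** Markov's inequality on a given event. The value [c = +oo] is allowed and yields
    [null_of_integral]. *)
Lemma markov_integral (g : Omega -> \bar R) (A : set Omega) (c : \bar R) :
  measurable A -> 0 <= c -> (forall w, 0 <= g w) -> (forall w, A w -> c <= g w) ->
  c * Q A <= \int[Q]_w g w.
Proof.
move=> mA c0 g0 cg; rewrite -integral_cst// integral_mkcond.
apply: le_integral_of_ge0 => w; rewrite patchE; case: ifPn => //=.
by rewrite inE => /cg.
Qed.

Lemma null_of_integral (g : Omega -> \bar R) (A : set Omega) :
  measurable A -> (forall w, 0 <= g w) -> (forall w, A w -> g w = +oo) ->
  \int[Q]_w g w < +oo -> Q A = 0.
Proof.
move=> mA g0 gA gfin; apply/eqP; rewrite eq_le measure_ge0 andbT leNgt.
apply/negP => QA.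
have := @markov_integral g A +oo mA (leey _) g0.
rewrite gt0_mulye// => h.
have : +oo <= \int[Q]_w g w by apply: h => w Aw; rewrite (gA w Aw).
by rewrite leNgt gfin.
Qed.

Lemma union_bound n (A : nat -> set Omega) (c : R) :
  (forall i, (i < n)%N -> measurable (A i)) ->
  (forall i, (i < n)%N -> Q (A i) <= c%:E) ->
  measurable (\bigcup_(i in `I_n) A i) /\
  Q (\bigcup_(i in `I_n) A i) <= (n%:R * c)%:E.
Proof.
move=> mA hA; rewrite bigcup_mkord; elim: n mA hA => [|n IH] mA hA.
  by rewrite big_ord0 mul0r measure0; split.
have [mU QU] := IH (fun i ni => mA i (ltnW ni)) (fun i ni => hA i (ltnW ni)).
rewrite big_ord_recr /=; split; first by apply: measurableU => //; exact: mA.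
apply: (le_trans (measureU2 _ mU _)); first exact: mA.
by rewrite -natr1 mulrDl mul1r EFinD leeD// hA.
Qed.

Lemma measurable_set_ltr (f g : Omega -> R) :
  measurable_fun [set: Omega] f -> measurable_fun [set: Omega] g ->
  measurable [set w | (f w < g w)%R].
Proof.
move=> mf mg; have := measurable_fun_ltr mf mg measurableT (Y := [set true]).
by rewrite setTI; exact.
Qed.

(** * Second moments of sums of orthogonal variables *)

Section Variance.
Variables (X : nat -> {mfun Omega >-> R}) (s2 : R).
Hypothesis X2 : forall i, \int[Q]_w (X i w ^+ 2)%:E = s2%:E.
Hypothesis orth : forall i j, i != j -> \int[Q]_w (X i w * X j w)%:E = 0.

Lemma square_integrable i : Q.-integrable setT (fun w => (X i w ^+ 2)%:E).
Proof.
apply/integrableP; split.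
  by apply/measurable_EFinP; apply: measurable_funX.
under eq_integral do rewrite gee0_abs ?lee_fin ?sqr_ge0//.
by rewrite X2 ltry.
Qed.

Lemma product_integrable i j : Q.-integrable setT (fun w => (X i w * X j w)%:E).
Proof.
apply: (le_integrable measurableT _ _ (integrableD measurableT
  (square_integrable i) (square_integrable j))).
  by apply/measurable_EFinP; apply: measurable_funM.
move=> w _ /=; rewrite lee_fin [leRHS]ger0_norm ?addr_ge0 ?sqr_ge0// ler_norml.
move: (X i w) (X j w) => x y.
have := sqr_ge0 (x + y)%R; have := sqr_ge0 (x - y)%R.
by move=> h1 h2; apply/andP; split; nra.
Qed.

Lemma block_orth a n j : (a + n <= j)%N ->
  Q.-integrable setT (fun w => ((\sum_(l < n) X (a + l)%N w) * X j w)%:E) /\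
  \int[Q]_w ((\sum_(l < n) X (a + l)%N w) * X j w)%:E = 0.
Proof.
elim: n => [|n IH] nj.
  under eq_fun do rewrite big_ord0 mul0r; split; first exact: integrable0.
  by apply: integral0_eq => w _; rewrite ?big_ord0 ?mul0r.
have [i1 z1] := IH (leq_trans (leq_add (leqnn a) (leqnSn n)) nj).
have i2 := product_integrable (a + n)%N j.
have z2 : \int[Q]_w (X (a + n)%N w * X j w)%:E = 0 by apply: orth; rewrite addnS in nj; lia.
have E w : ((\sum_(l < n.+1) X (a + l)%N w) * X j w)%:E =
  ((\sum_(l < n) X (a + l)%N w) * X j w)%:E + (X (a + n)%N w * X j w)%:E.
  by rewrite big_ord_recr/= mulrDl EFinD.
split; first by under eq_fun do rewrite E; exact: integrableD.
under eq_integral do rewrite E.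
by rewrite integralD// z1 z2 adde0.
Qed.

(** Pythagoras: [block_orth] removes the cross term, so each new increment adds exactly [s2]. *)
Lemma block_variance a n :
  Q.-integrable setT (fun w => ((\sum_(l < n) X (a + l)%N w) ^+ 2)%:E) /\
  \int[Q]_w ((\sum_(l < n) X (a + l)%N w) ^+ 2)%:E = (n%:R * s2)%:E.
Proof.
elim: n => [|n [i1 z1]].
  under eq_fun do rewrite big_ord0 expr0n/=; split; first exact: integrable0.
  by rewrite mul0r; apply: integral0_eq => w _; rewrite ?big_ord0 ?expr0n.
have [i2 z2] := block_orth (leqnn (a + n)%N).
have i3 := square_integrable (a + n)%N.
have i2' := integrableZl measurableT 2 i2.
have E w : ((\sum_(l < n.+1) X (a + l)%N w) ^+ 2)%:E =
  ((\sum_(l < n) X (a + l)%N w) ^+ 2)%:E +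
  (2%:E * ((\sum_(l < n) X (a + l)%N w) * X (a + n)%N w)%:E + (X (a + n)%N w ^+ 2)%:E).
  by rewrite big_ord_recr/= -EFinM -!EFinD; congr EFin; ring.
split.
  by under eq_fun do rewrite E; apply: integrableD => //; exact: integrableD.
under eq_integral do rewrite E.
rewrite integralD//; last exact: integrableD.
rewrite integralD// integralZl// z2 mule0 add0e z1 X2 -EFinD -natr1.
by congr EFin; ring.
Qed.

Lemma measurable_block a n :
  measurable_fun [set: Omega] (fun w => \sum_(l < n) X (a + l)%N w)%R.
Proof. by apply: measurable_sum => i. Qed.

Lemma block_deviation a n (D : R) : (0 < D)%R ->
  measurable [set w | (D < `|\sum_(l < n) X (a + l)%N w|)%R] /\
  Q [set w | (D < `|\sum_(l < n) X (a + l)%N w|)%R] <= (n%:R * s2 / D ^+ 2)%:E.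
Proof.
move=> D0; have mA : measurable [set w | (D < `|\sum_(l < n) X (a + l)%N w|)%R].
  apply: measurable_set_ltr => //.
  by apply: measurableT_comp => //; exact: measurable_block.
split=> //; have [_ V] := block_variance a n.
rewrite EFinM muleC lee_pdivlMl ?exprn_gt0// -V.
apply: markov_integral => // [|w|w /= Dw]; rewrite lee_fin ?sqr_ge0//.
by rewrite -[leRHS]real_normK ?num_real// lerXn2r ?nnegrE ?normr_ge0 ?ltW.
Qed.

End Variance.
End ProbabilityBounds.

(** * Logarithmic moments *)

Section LogMoments.
Variable R : realType.
Implicit Types v : envval R.
Local Open Scope ereal_scope.

(* For a [good] value this is [logplus (var_ratio v.1)]; [mu^-2] is written
   [expR (- 2 * logmean v)]. *)
Definition logvar v : R :=
  Num.max 0%R (ln (fine (second_moment v.1) * expR (- 2 * logmean v) - 1)%R).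

(** Where [fine] and [ln] return default values, that is for a mean that is nonpositive or infinite,
    the right-hand side is [+oo]. *)
Lemma logmean_sqr_le v : ((logmean v ^+ 2)%R)%:E <= `| elog (mean v.1) | `^ 2.
Proof.
rewrite /logmean; case: (mean v.1) => [r| |] /=.
- case: ifPn => [r0|r0] /=; first by rewrite pnatr_eq0 /= leey.
  by rewrite lee_fin powR_mulrn ?normr_ge0// real_normK ?num_real.
- by rewrite pnatr_eq0 /= leey.
- by rewrite pnatr_eq0 /= leey.
Qed.

Lemma second_moment_ge0 v : (forall k, (0 <= v.1 k)%R) -> 0 <= second_moment v.1.
Proof.
by move=> v0; apply: nneseries_ge0 => k _ _; rewrite lee_fin mulr_ge0 ?exprn_ge0.
Qed.

Lemma expR_N2ln (r : R) : (0 < r)%R -> expR (- 2 * ln r) = (r ^- 2)%R.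
Proof.
by move=> r0; rewrite mulNr expRN mulrC -powR_mulrn ?ltW// /powR gt_eqF// mulrC.
Qed.

Lemma logplus_ge0 (x : \bar R) : 0 <= logplus x.
Proof.
case: x => [r| |] //=.
by case: ifPn => // r1; rewrite lee_fin ln_ge0// ltW.
Qed.

Lemma logplus_var_ratio_y v : (forall k, (0 <= v.1 k)%R) ->
  second_moment v.1 = +oo -> logplus (var_ratio v.1) = +oo.
Proof.
move=> v0 hs; rewrite /var_ratio /Defs.variance hs.
case: (mean v.1) => [r| |] //=; case: ifPn => // r0.
by rewrite /= gt0_mulye ?lte_fin ?invr_gt0 ?exprn_gt0.
Qed.

Lemma logvar_sqr_le v : (forall k, (0 <= v.1 k)%R) ->
  ((logvar v ^+ 2)%R)%:E <= logplus (var_ratio v.1) * logplus (var_ratio v.1).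
Proof.
move=> v0; have s0 := second_moment_ge0 v0.
have yy : ((logvar v ^+ 2)%R)%:E <= +oo * +oo by rewrite mulyy leey.
rewrite /logvar /logmean.
case hs : (second_moment v.1) s0 => [s| |]// s0; last first.
  by rewrite logplus_var_ratio_y// mulyy leey.
move: yy; rewrite /logvar /logmean hs /var_ratio /Defs.variance hs.
case: (mean v.1) => [r| |] //; case: ifPn => // r0 _ /=.
rewrite expR_N2ln//.
have -> : ((s - r ^+ 2) / r ^+ 2 = s / r ^+ 2 - 1)%R.
  by field; rewrite gt_eqF.
set z := (s / r ^+ 2 - 1)%R; case: ifPn => z1.
  by rewrite max_r -?EFinM ?lee_fin ?expr2//; apply: ln_ge0; exact: ltW.
(* For [z <= 1] both logarithms are cut off at 0; this includes [z <= 0], where [ln] is 0 by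
   default. *)
rewrite max_l ?expr0n ?mule0//; rewrite -leNgt in z1.
exact: ln_le0.
Qed.

(** The logarithm in [logvar] is that of [z - 1], with [z] the moment ratio. Either [z <= 2], or
    [z <= 2 (z - 1)]; hence the factor 2. *)
Lemma moment_ratio_le v : good v -> (moment_ratio v <= 2 * expR (logvar v))%R.
Proof.
move=> [_ mu0 _ _]; rewrite /logvar /moment_ratio /logmean expR_N2ln//.
set z := (_ / _)%R; have [z2|z2] := leP z 2%R.
  by apply: (le_trans z2); rewrite ler_peMr// -expR0 ler_expR le_max lexx.
have z1 : (0 < z - 1)%R by lra.
apply: (@le_trans _ _ (2 * (z - 1))%R); first lra.
by rewrite ler_wpM2l// -[leLHS]lnK// ler_expR le_max lexx orbT.
Qed.

Lemma goodP v : is_pmf v.1 -> 0 < mean v.1 -> mean v.1 < +oo ->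
  second_moment v.1 < +oo -> good v.
Proof.
move=> hp m0 m1 s1; have s0 := second_moment_ge0 hp.1.
have mf : mean v.1 \is a fin_num by rewrite ge0_fin_numE ?ltW.
have sf : second_moment v.1 \is a fin_num by rewrite ge0_fin_numE.
by split; rewrite ?fineK// fine_gt0// m0.
Qed.

Lemma measurable_logmean :
  measurable_fun [set: envT R] (fun v : envT R => logmean (absenv v)).
Proof.
apply: measurableT_comp => //.
by apply: measurableT_comp => //; exact: measurable_mean.
Qed.

Lemma measurable_logvar :
  measurable_fun [set: envT R] (fun v : envT R => logvar (absenv v)).
Proof.
apply: measurable_maxr => //; apply: measurableT_comp => //.
apply: measurable_funB => //; apply: measurable_funM.
  by apply: measurableT_comp => //; exact: measurable_second_moment.
apply: measurableT_comp => //; apply: measurable_funM => //.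
exact: measurable_logmean.
Qed.

Lemma measurable_elog_mean :
  measurable_fun [set: envT R] (fun v : envT R => elog (mean (absenv v).1)).
Proof.
rewrite (_ : (fun _ => _) = (fun v : envT R => if mean (absenv v).1 <= 0 then -oo
  else if +oo <= mean (absenv v).1 then +oo else (logmean (absenv v))%:E)).
  apply: measurable_fun_ifT => //.
    by apply: measurable_fun_lee => //; exact: measurable_mean.
  apply: measurable_fun_ifT => //.
    by apply: measurable_fun_lee => //; exact: measurable_mean.
  by apply/measurable_EFinP; exact: measurable_logmean.
apply: funext => v; rewrite /logmean; case: (mean _) => [r| |] //=.
by rewrite leNye.
Qed.

End LogMoments.

(** * Almost sure escape *)

Section Annealed.
Context (R : realType) (d : measure_display) (Omega : measurableType d)
  (Q : probability Omega R) (env : nat -> Omega -> envval R).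
Hypothesis menv : forall i B, env_meas B -> measurable (env i @^-1` B).
Hypothesis env_ge0 : forall i w k, 0 <= (env i w).1 k.
Hypothesis env_sum1 : forall i w, (\sum_(k <oo) ((env i w).1 k)%:E)%E = 1%E.
Hypothesis iid : env_iid Q env.
Hypothesis logmean_moments : forall delta : R, 0 < delta < 6 ->
  (\int[Q]_w (`| elog (mean (env 0%N w).1) | `^ delta) < +oo)%E.
Hypothesis logmean_centered : (\int[Q]_w elog (mean (env 0%N w).1))%E = 0%E.
Hypothesis logvar_moment : (\int[Q]_w (logplus (var_ratio (env 0%N w).1) *
  logplus (var_ratio (env 0%N w).1)) < +oo)%E.
Local Open Scope ereal_scope.

Let envm i : {mfun Omega >-> envT R} :=
  HB.pack (env i : Omega -> envT R) (isMeasurableFun.Build _ _ _ _ _ (measurable_env menv i)).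

Let logmean_meas i : measurable_fun [set: Omega] (fun w => logmean (absenv (env i w))).
Proof. exact: (measurableT_comp (@measurable_logmean R) (measurable_env menv i)). Qed.

Let X i : {mfun Omega >-> R} := HB.pack (fun w => logmean (absenv (env i w)))
  (isMeasurableFun.Build _ _ _ _ _ (logmean_meas i)).

Let logvar_meas i : measurable_fun [set: Omega] (fun w => logvar (absenv (env i w))).
Proof. exact: (measurableT_comp (@measurable_logvar R) (measurable_env menv i)). Qed.

Let envE i w : absenv (env i w) = env i w.
Proof. by apply: absenv_id => k; exact: env_ge0. Qed.

Let env_pmf i w : is_pmf (env i w).1.
Proof. by split => // k; exact: env_ge0. Qed.

Lemma integral_env (f : envT R -> \bar R) i : measurable_fun [set: envT R] f ->
  \int[Q]_w f (env i w) = \int[Q]_w f (env 0%N w).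
Proof.
move=> mf; apply: (integral_same_law (phi := envm i) (psi := envm 0%N)) => //.
by move=> B mB; exact: iid.1.
Qed.

Let degenerate : set (envT R) := [set v : envT R | mean (absenv v).1 <= 0] `|`
  [set v : envT R | +oo <= mean (absenv v).1].

Let infinite_second : set (envT R) :=
  [set v : envT R | +oo <= second_moment (absenv v).1].

Let measurable_degenerate : measurable degenerate.
Proof.
apply: measurableU.
  have := measurable_lee measurableT (@measurable_mean R) (measurable_cst 0).
  by rewrite setTI.
have := measurable_lee measurableT (measurable_cst +oo) (@measurable_mean R).
by rewrite setTI.
Qed.

Let measurable_infinite_second : measurable infinite_second.
Proof.
have := measurable_lee measurableT (measurable_cst +oo) (@measurable_second_moment R).
by rewrite setTI.
Qed.

(** On this event [elog] is infinite, which the finite moment of order [delta = 2] excludes up to a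
    null set. *)
Lemma degenerate_mean_null : Q (env 0%N @^-1` degenerate) = 0.
Proof.
apply: (null_of_integral (g := fun w => `| elog (mean (env 0%N w).1) | `^ 2)).
- exact: menv.
- by move=> w; exact: poweR_ge0.
- move=> w hw; have : mean (env 0%N w).1 <= 0 \/ +oo <= mean (env 0%N w).1.
    by rewrite -envE.
  case: (mean (env 0%N w).1) => [r| |] /=; try by rewrite pnatr_eq0.
  by rewrite leye_eq /= lee_fin => -[->|//] /=; rewrite pnatr_eq0.
- by apply: logmean_moments; rewrite ltr0n ltr_nat.
Qed.

Lemma infinite_second_moment_null : Q (env 0%N @^-1` infinite_second) = 0.
Proof.
apply: (null_of_integral (g := fun w => logplus (var_ratio (env 0%N w).1) *
  logplus (var_ratio (env 0%N w).1))) => //.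
- exact: menv.
- by move=> w; apply: mule_ge0; exact: logplus_ge0.
- move=> w hw; have : +oo <= second_moment (env 0%N w).1 by rewrite -envE.
  rewrite leye_eq => /eqP h.
  by rewrite logplus_var_ratio_y ?mulyy// => k; exact: env_ge0.
Qed.

Lemma not_good_negligible : Q.-negligible [set w | ~ forall i, good (env i w)].
Proof.
have N0 i : Q.-negligible (env i @^-1` degenerate `|` env i @^-1` infinite_second).
  apply: negligibleU; (apply/negligibleP; first by exact: menv).
    exact: etrans (iid.1 i _ measurable_degenerate) degenerate_mean_null.
  exact: etrans (iid.1 i _ measurable_infinite_second) infinite_second_moment_null.
apply: negligibleS (negligible_bigcup N0) => w /= /existsNP[i ng].
exists i => //=; apply: contrapT => /not_orP[/not_orP[n1 n2] n3]; apply: ng.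
by apply: goodP => //; rewrite ltNge -envE; exact/negP.
Qed.

Lemma logmean_variance : exists2 s2 : R, (0 <= s2)%R &
  forall i, \int[Q]_w (X i w ^+ 2)%:E = s2%:E.
Proof.
have fin : \int[Q]_w (X 0%N w ^+ 2)%:E \is a fin_num.
  rewrite ge0_fin_numE; last by apply: integral_ge0 => w _; rewrite lee_fin sqr_ge0.
  apply: le_lt_trans (logmean_moments (delta := 2) _); last by rewrite ltr0n ltr_nat.
  apply: le_integral_of_ge0 => w; first by rewrite lee_fin sqr_ge0.
  by rewrite /= envE; exact: logmean_sqr_le.
exists (fine (\int[Q]_w (X 0%N w ^+ 2)%:E)) => [|i].
  by rewrite fine_ge0// integral_ge0// => w _; rewrite lee_fin sqr_ge0.
have mf : measurable_fun [set: envT R] (fun v : envT R => (logmean (absenv v) ^+ 2)%:E).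
  by apply/measurable_EFinP; apply: measurable_funX; exact: measurable_logmean.
rewrite (fineK fin); exact: (integral_env i mf).
Qed.

Lemma logvar_second_moment : exists2 t2 : R, (0 <= t2)%R &
  forall i, \int[Q]_w (logvar (absenv (env i w)) ^+ 2)%:E = t2%:E.
Proof.
have fin : \int[Q]_w (logvar (absenv (env 0%N w)) ^+ 2)%:E \is a fin_num.
  rewrite ge0_fin_numE; last by apply: integral_ge0 => w _; rewrite lee_fin sqr_ge0.
  apply: le_lt_trans logvar_moment.
  apply: le_integral_of_ge0 => w; first by rewrite lee_fin sqr_ge0.
  by rewrite envE; apply: logvar_sqr_le => k; exact: env_ge0.
exists (fine (\int[Q]_w (logvar (absenv (env 0%N w)) ^+ 2)%:E)) => [|i].
  by rewrite fine_ge0// integral_ge0// => w _; rewrite lee_fin sqr_ge0.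
have mf : measurable_fun [set: envT R] (fun v : envT R => (logvar (absenv v) ^+ 2)%:E).
  by apply/measurable_EFinP; apply: measurable_funX; exact: measurable_logvar.
rewrite (fineK fin); exact: (integral_env i mf).
Qed.

Lemma logmean_integrable i : Q.-integrable setT (fun w => (X i w)%:E).
Proof.
have [s2 _ hs] := logmean_variance.
have i1 : Q.-integrable setT (fun _ : Omega => 1%:E : \bar R).
  exact: finite_measure_integrable_cst.
apply: (le_integrable measurableT _ _ (integrableD measurableT i1
  (square_integrable hs i))); first by apply/measurable_EFinP.
move=> w _ /=; rewrite lee_fin [leRHS]ger0_norm ?addr_ge0 ?sqr_ge0// ler_norml.
by move: (logmean _) => x; apply/andP; split; nra.
Qed.

(** On good environments [elog] of the mean is finite and equals [logmean], so the centering
    hypothesis carries over almost surely. *)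
Lemma logmean_expectation i : \int[Q]_w (X i w)%:E = 0.
Proof.
rewrite (@integral_env (fun v => (logmean (absenv v))%:E)); last first.
  by apply/measurable_EFinP; exact: measurable_logmean.
rewrite -[RHS]logmean_centered; apply: ae_eq_integral => //.
- exact/measurable_EFinP.
- rewrite (_ : (fun _ => _) = (fun w => elog (mean (absenv (env 0%N w)).1))).
    exact: (measurableT_comp (@measurable_elog_mean R) (measurable_env menv 0%N)).
  by apply: funext => w; rewrite envE.
- apply: negligibleS not_good_negligible => w /= h g; apply: h => _.
  have [_ mu0 hmu _] := g 0%N; rewrite envE /logmean hmu /=.
  by rewrite leNgt mu0.
Qed.

Lemma logmean_orth i j : i != j -> \int[Q]_w (X i w * X j w)%:E = 0.
Proof.
move=> ij; have [s2 _ hs] := logmean_variance.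
apply: integral_indep_mul_eq0.
- move=> A B mA mB; have [same ind] := iid.
  pose L : envT R -> R := fun v => logmean (absenv v).
  have mL C : measurable C -> env_meas (L @^-1` C).
    by move=> mC; have := @measurable_logmean R measurableT C mC; rewrite setTI.
  have := ind [:: i; j] (fun l => if l == i then L @^-1` A else L @^-1` B).
  rewrite /= inE ij => /(_ isT) h.
  have {}h := h (fun l => _).
  rewrite !big_cons big_nil mule1 eqxx (negbTE (_ : j != i)) ?(eq_sym j)// in h.
  rewrite -h; last by move=> l; case: ifP => _; exact: mL.
  congr (Q _); apply/seteqP; split => [w /= [hA hB] l /=|w /= h'].
    by rewrite !inE => /orP[] /eqP ->; rewrite ?eqxx// eq_sym (negbTE ij).
  split; first by have := h' i; rewrite /= !inE eqxx/= => /(_ isT).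
  by have := h' j; rewrite /= !inE eqxx orbT eq_sym (negbTE ij) => /(_ isT).
- exact: logmean_integrable.
- exact: (product_integrable hs).
- exact: logmean_expectation.
Qed.

(** Level [l] has [2^(m-l)] dyadic blocks, each deviating with probability at most [2^l s2 / D^2] by
    Chebyshev. So every level costs [2^m s2 / D^2], there are [m + 1] levels, and chaining
    recombines them. *)
Lemma walk_deviation (s2 D : R) m :
  (forall i, \int[Q]_w (X i w ^+ 2)%:E = s2%:E) -> (0 < D)%R ->
  exists E : set Omega, [/\ measurable E,
    Q E <= (m.+1%:R * (2 ^+ m * s2 / D ^+ 2))%:E &
    forall w, ~ E w -> forall i, (i <= 2 ^ m)%N ->
      (`|\sum_(l < i) logmean (env l w)| <= m.+1%:R * D)%R].
Proof.
move=> hs D0.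
pose B l b := [set w | (D < `|\sum_(q < 2 ^ l) X (b * 2 ^ l + q)%N w|)%R].
have inner l : (l < m.+1)%N -> measurable (\bigcup_(b in `I_(2 ^ (m - l))) B l b) /\
    Q (\bigcup_(b in `I_(2 ^ (m - l))) B l b) <= (2 ^+ m * s2 / D ^+ 2)%:E.
  move=> lm; have H b := block_deviation hs logmean_orth (b * 2 ^ l)%N (2 ^ l)%N D0.
  have [mU QU] := union_bound (n := (2 ^ (m - l))%N) (A := B l)
     (fun b _ => (H b).1) (fun b _ => (H b).2).
  split=> //; apply: le_trans QU _; rewrite lee_fin !mulrA -natrM -expnD subnK//.
  by rewrite natrX.
have [mU QU] := union_bound (n := m.+1) (fun l lm => (inner l lm).1)
  (fun l lm => (inner l lm).2).
exists (\bigcup_(l in `I_m.+1) \bigcup_(b in `I_(2 ^ (m - l))) B l b); split => //.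
move=> w nE i im.
have := @dyadic_chaining R (fun n => \sum_(l < n) X l w)%R D m (ltW D0).
rewrite big_ord0.
have H : forall l b, (l <= m)%N -> (b < 2 ^ (m - l))%N ->
  (`|\sum_(l0 < b.+1 * 2 ^ l) X l0 w - \sum_(l0 < b * 2 ^ l) X l0 w| <= D)%R.
  move=> l b lm bm.
  have -> : (\sum_(l0 < b.+1 * 2 ^ l) X l0 w - \sum_(l0 < b * 2 ^ l) X l0 w =
      \sum_(q < 2 ^ l) X (b * 2 ^ l + q)%N w)%R.
    rewrite mulSn addnC.
    by rewrite big_split_ord/=; apply/eqP; rewrite subr_eq addrC.
  by rewrite leNgt; apply/negP => h; apply: nE; exists l => //; exists b.
move=> /(_ H i im); rewrite subr0.
by under eq_bigr do rewrite /= envE.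
Qed.

Lemma logvar_deviation (t2 D : R) m :
  (forall i, \int[Q]_w (logvar (absenv (env i w)) ^+ 2)%:E = t2%:E) -> (0 < D)%R ->
  exists E : set Omega, [/\ measurable E, Q E <= (2 ^+ m * (t2 / D ^+ 2))%:E &
    forall w, ~ E w -> forall i, (i < 2 ^ m)%N -> (logvar (env i w) <= D)%R].
Proof.
move=> ht D0; pose B i := [set w | (D < logvar (absenv (env i w)))%R].
have mB i : measurable (B i) by apply: measurable_set_ltr.
have QB i : Q (B i) <= (t2 / D ^+ 2)%:E.
  rewrite EFinM muleC lee_pdivlMl ?exprn_gt0// -(ht i).
  apply: markov_integral => // [|w|w /= Dw]; rewrite lee_fin ?sqr_ge0//.
  by rewrite lerXn2r ?nnegrE ?ltW// (lt_trans D0).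
have [mU QU] := union_bound (n := (2 ^ m)%N) (fun i _ => mB i) (fun i _ => QB i).
exists (\bigcup_(i in `I_(2 ^ m)) B i); split => //; first by rewrite -natrX.
move=> w nE i im; rewrite leNgt -envE; apply/negP => h; apply: nE.
by exists i.
Qed.

(** One generation succeeds with probability [q >= c/p]. By independence all [2^m] fail with
    probability [(1-q)^(2^m)], at most [1 / (2^m q)] by [bernoulli_inv]. *)
Lemma immigration_deviation (K c p : R) m : (0 < c)%R -> (0 < p)%R ->
  (c%:E <= p%:E * Q [set w | (K < ln ((env 0%N w).2)%:R)%R]) ->
  exists E : set Omega, [/\ measurable E, Q E <= (p / (c * 2 ^+ m))%:E &
    forall w, ~ E w -> exists2 j, (2 ^ m <= j < 2 ^ m.+1)%N &
      (K < ln ((env j w).2)%:R)%R].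
Proof.
move=> c0 p0 hp.
pose B : set (envT R) := [set v : envT R | ~ (K < ln (v.2)%:R)%R].
have mB : measurable B by exact: (measurable_immigrants (fun n => ~ (K < ln n%:R)%R)).
pose C := [set w | (K < ln ((env 0%N w).2)%:R)%R].
have mC : measurable C.
  have h := @measurable_immigrants R (fun n => (K < ln (n%:R : R))%R).
  exact: (@menv 0%N _ h).
have QBC : Q (env 0%N @^-1` B) = 1 - Q C by rewrite -probability_setC.
have [q qE] : exists q : R, Q C = q%:E.
  by exists (fine (Q C)); rewrite fineK// fin_num_measure.
have q0 : (0 <= q)%R by rewrite -lee_fin -qE measure_ge0.
have q1 : (q <= 1)%R by rewrite -lee_fin -qE probability_le1.
have cq : (c <= p * q)%R by rewrite -lee_fin EFinM -qE.
exists [set w | forall i, (i < 2 ^ m)%N -> B (env (i + 2 ^ m)%N w)]; split.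
- rewrite (_ : [set w | _] = \bigcap_(i in `I_(2 ^ m)) (env (i + 2 ^ m)%N @^-1` B)).
    by apply: fin_bigcap_measurable => // i _; exact: menv.
  by apply/seteqP; split => [x /= h i /= ?|x /= h i ?]; exact: h.
- rewrite (envseq_cylinder_prob iid (2 ^ m) (2 ^ m) (B := fun=> B))//.
  under eq_bigr do rewrite QBC qE -EFinB.
  rewrite prodEFin lee_fin prodr_const card_ord.
  have := @bernoulli_inv R q (2 ^ m)%N; rewrite q0 q1 => /(_ isT).
  set n := (2 ^ m)%N; set u := ((1 - q) ^+ n)%R => hu.
  have n0 : (0 < n%:R :> R)%R by rewrite ltr0n expn_gt0.
  have u0 : (0 <= u)%R by rewrite exprn_ge0// subr_ge0.
  rewrite -natrX -/n ler_pdivlMr ?mulr_gt0//.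
  apply: (@le_trans _ _ (u * (p * q * n%:R))%R).
    by rewrite ler_wpM2l// ler_wpM2r// ltW.
  have : (u * (n%:R * q) <= 1)%R by apply: le_trans hu; rewrite ler_wpM2l// lerDr.
  by move=> /(ler_wpM2l (ltW p0)); nra.
- move=> w /= /existsNP[i /not_implyP[im /contrapT hK]].
  by exists (i + 2 ^ m)%N => //; rewrite leq_addl expnS mul2n -addnn ltn_add2r.
Qed.

(** The conditions required by [hit_prob_le_half] at scale [m], with [D m = rho^m]. *)
Definition separated (x : nat) (rho : R) m (e : nat -> envval R) : Prop :=
  [/\ ((x + 10)%:R <= rho ^+ m)%R,
   (forall i, (i <= 2 ^ (m + 2))%N ->
     `|\sum_(l < i) logmean (e l)| <= m.+3%:R * rho ^+ m)%R,
   (forall i, (i < 2 ^ (m + 2))%N -> moment_ratio (e i) <= 2 * expR (rho ^+ m))%R &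
   exists2 j, (2 ^ m <= j < 2 ^ m.+1)%N &
     (4 * m.+3%:R * rho ^+ m < ln ((e j).2)%:R)%R].

(** The ratio [2 / rho^2] comes from the walk and the variances, [rho^lambda / 2] from the
    immigration. The horizon [2^(m+2)] accounts for the constants 4, and [(m+3)^2] dominates all
    polynomial factors. *)
Lemma not_separated_prob (x : nat) (rho lambda c s2 t2 : R) m :
  (forall i, \int[Q]_w (X i w ^+ 2)%:E = s2%:E) ->
  (forall i, \int[Q]_w (logvar (absenv (env i w)) ^+ 2)%:E = t2%:E) ->
  (0 <= s2)%R -> (0 <= t2)%R -> (0 < lambda < 2)%R -> (0 < c)%R -> (1 < rho)%R ->
  ((x + 10)%:R <= rho ^+ m)%R ->
  c%:E <= ((4 * m.+3%:R * rho ^+ m) `^ lambda)%:E *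
    Q [set w | (4 * m.+3%:R * rho ^+ m < ln ((env 0%N w).2)%:R)%R] ->
  exists E : set Omega, [/\ measurable E,
    Q E <= ((4 * s2 + 4 * t2 + 16 / c) *
      (m.+3%:R ^+ 2 * (Num.max (2 / rho ^+ 2) (rho `^ lambda / 2)) ^+ m))%:E &
    forall w, (forall i, good (env i w)) -> ~ E w -> separated x rho m (envseq env w)].
Proof.
move=> hs ht s20 t20 /andP[l0 l2] c0 r1 xr hc.
set tau := Num.max _ _.
have r0 : (0 < rho)%R by rewrite (lt_trans _ r1).
have D0 : (0 < rho ^+ m)%R by rewrite exprn_gt0.
have K0 : (0 < 4 * m.+3%:R * rho ^+ m)%R by rewrite !mulr_gt0.
have m3 : (1 <= m.+3%:R :> R)%R by rewrite ler1n.
have a0 : (0 <= 2 / rho ^+ 2)%R by rewrite divr_ge0// exprn_ge0// ltW.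
have tau0 : (0 <= tau)%R by rewrite le_max a0.
have u1 : ((2 ^+ m / (rho ^+ m) ^+ 2) <= tau ^+ m :> R)%R.
  rewrite -exprM mulnC exprM -exprVn -exprMn.
  by rewrite lerXn2r ?nnegrE// le_max lexx.
have u2 : ((rho `^ lambda) ^+ m / 2 ^+ m <= tau ^+ m :> R)%R.
  rewrite -exprVn -exprMn lerXn2r ?nnegrE//; last by rewrite le_max lexx orbT.
  by rewrite divr_ge0// powR_ge0.
(* Since [4 (m+3) >= 1] and [lambda < 2], its power [lambda] is at most its square. *)
have pK : ((4 * m.+3%:R * rho ^+ m) `^ lambda <= 16 * m.+3%:R ^+ 2 * (rho `^ lambda) ^+ m)%R.
  have K4 : (0 <= 4 * m.+3%:R :> R)%R by rewrite mulr_ge0.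
  rewrite (powRM _ K4 (ltW D0)); apply: ler_pM; rewrite ?powR_ge0//.
    have -> : (16 * m.+3%:R ^+ 2 = (4 * m.+3%:R) ^+ 2 :> R)%R by rewrite exprMn; ring.
    rewrite -(powR_mulrn 2 K4); apply: ler_powR; last exact: ltW.
    by lra.
  rewrite -(powR_mulrn m (ltW r0)) -(powR_mulrn m (powR_ge0 rho lambda)).
  by rewrite -!powRrM mulrC.
have [EA [mA QA hA]] := walk_deviation (m + 2) hs D0.
have [EB [mB QB hB]] := logvar_deviation (m + 2) ht D0.
have [EC [mC QC hC]] := immigration_deviation m c0 (powR_gt0 lambda K0) hc.
exists (EA `|` EB `|` EC); split.
- by apply: measurableU => //; exact: measurableU.
- pose u := (2 ^+ m / (rho ^+ m) ^+ 2 : R)%R; rewrite -/u in u1.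
  set M := m.+3%:R in m3 pK *; set T := (tau ^+ m)%R in u1 u2 *.
  have u0 : (0 <= u)%R by rewrite divr_ge0// exprn_ge0// ltW.
  have T0 : (0 <= T)%R by exact: le_trans u1.
  have M2 : (M <= M ^+ 2)%R by nra.
  have MT : (M * u <= M ^+ 2 * T)%R by apply: ler_pM => //; lra.
  have uT : (u <= M ^+ 2 * T)%R by nra.
  have bA : ((m + 2).+1%:R * (2 ^+ (m + 2) * s2 / (rho ^+ m) ^+ 2) <=
      4 * s2 * (M ^+ 2 * T))%R.
    have -> : ((m + 2).+1%:R * (2 ^+ (m + 2) * s2 / (rho ^+ m) ^+ 2) = 4 * s2 * (M * u))%R.
      by rewrite /u (_ : (m + 2).+1%:R = M) ?exprD; [ring|rewrite /M addn2].
    by rewrite ler_wpM2l// mulr_ge0.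
  have bB : (2 ^+ (m + 2) * (t2 / (rho ^+ m) ^+ 2) <= 4 * t2 * (M ^+ 2 * T))%R.
    have -> : (2 ^+ (m + 2) * (t2 / (rho ^+ m) ^+ 2) = 4 * t2 * u)%R.
      by rewrite /u exprD; ring.
    by rewrite ler_wpM2l// mulr_ge0.
  have bC : ((4 * M * rho ^+ m) `^ lambda / (c * 2 ^+ m) <= 16 / c * (M ^+ 2 * T))%R.
    apply: (@le_trans _ _ (16 * M ^+ 2 * (rho `^ lambda) ^+ m / (c * 2 ^+ m))%R).
      by rewrite ler_wpM2r// invr_ge0 mulr_ge0 ?exprn_ge0// ltW.
    rewrite [leLHS](_ : _ = 16 / c * (M ^+ 2 * ((rho `^ lambda) ^+ m / 2 ^+ m)))%R.
      apply: ler_wpM2l; first by rewrite divr_ge0// ltW.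
      by apply: ler_wpM2l => //; exact: sqr_ge0.
    by field; rewrite expf_eq0 pnatr_eq0 andbF gt_eqF.
  have mAB : measurable (EA `|` EB) by exact: measurableU.
  apply: (le_trans (measureU2 _ mAB mC)).
  rewrite 2!mulrDl 2!EFinD; apply: leeD; last by apply: le_trans QC _; rewrite lee_fin.
  apply: (le_trans (measureU2 _ mA mB)).
  by apply: leeD; [apply: le_trans QA _|apply: le_trans QB _]; rewrite lee_fin.
- move=> w hg /not_orP[/not_orP[nA nB] nC]; split => //.
  + by move=> i im; have := hA w nA i im; rewrite addn2.
  + move=> i im; apply: (le_trans (moment_ratio_le (hg i))).
    by rewrite ler_wpM2l// ler_expR; exact: hB.
  + exact: hC.
Qed.

(** Borel-Cantelli: the exceptional probabilities are bounded by [C (m+3)^2 tau^m] with [tau < 1],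
    so their limsup event is null. *)
Lemma separated_eventually (x : nat) (lambda c : R) : (0 < lambda < 2)%R -> (0 < c)%R ->
  (\forall t \near +oo%R,
    c%:E <= (t `^ lambda)%:E * Q [set w | (t < ln ((env 0%N w).2)%:R)%R]) ->
  exists2 rho : R, (1 < rho)%R &
  Q.-negligible [set w | (forall i, good (env i w)) /\
    ~ exists m0, forall m, (m0 <= m)%N -> separated x rho m (envseq env w)].
Proof.
move=> hl c0 [t0 [_ ht0]].
have [rho [r1 hr1 hr2]] := scale_exists hl; exists rho => //.
have [s2 s20 hs] := logmean_variance.
have [t2 t20 ht] := logvar_second_moment.
(* From [m1] on, [rho^m] exceeds both [x + 10] and the threshold [t0] beyond which the tail bound
   holds. *)
have [m1 hm1] := expr_eventually_ge (Num.max (x + 10)%:R (t0 + 1))%R r1.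
set tau := Num.max (2 / rho ^+ 2)%R (rho `^ lambda / 2)%R.
pose C := (4 * s2 + 4 * t2 + 16 / c)%R.
have C0 : (0 <= C)%R by rewrite !addr_ge0 ?mulr_ge0// invr_ge0 ltW.
have tau0 : (0 <= tau)%R by rewrite le_max divr_ge0 ?exprn_ge0 ?(le_trans _ (ltW r1)).
have tau1 : (tau < 1)%R by rewrite gt_max hr1.
have : forall m, exists E : set Omega, [/\ measurable E,
    Q E <= (C * (m.+3%:R ^+ 2 * tau ^+ m))%:E &
    (m1 <= m)%N -> forall w, (forall i, good (env i w)) -> ~ E w ->
      separated x rho m (envseq env w)].
  move=> m; have [mm|mm] := leqP m1 m; last first.
    (* Scales below [m1] carry no claim, so the empty event serves. *)
    exists set0; split => //.
    by rewrite measure0 lee_fin !mulr_ge0 ?exprn_ge0.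
  have := hm1 m mm; rewrite ge_max => /andP[hx htm].
  have [|E [mE QE hE]] := not_separated_prob hs ht s20 t20 hl c0 r1 hx.
    apply: ht0; apply: (@lt_le_trans _ _ (rho ^+ m)%R); first lra.
    apply: ler_peMl; first by rewrite exprn_ge0// (le_trans _ (ltW r1)).
    by rewrite -natrM ler1n.
  by exists E; split => // _.
move=> /choice[E hE].
have mE m : measurable (E m) by case: (hE m).
exists (lim_sup_set E); split.
- apply: bigcap_measurable => // n _; apply: bigcup_measurable => // j _; exact: mE.
- apply: lim_sup_set_cvg0 => //.
  apply: (@le_lt_trans _ _ (\sum_(m <oo) (C%:E * (m.+3%:R ^+ 2 * tau ^+ m)%:E))).
    apply: lee_nneseries => [m _ _|m _]; first exact: measure_ge0.
    by rewrite -EFinM; case: (hE m).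
  rewrite nneseriesZl; last by move=> m _; rewrite lee_fin mulr_ge0 ?exprn_ge0.
  rewrite lte_mul_pinfty ?lee_fin//.
  by apply: quadratic_geometric_series; rewrite tau0.
- move=> w [hg hn] n _; apply: contrapT => nE; apply: hn.
  exists (maxn m1 n) => m; rewrite geq_max => /andP[m1m nm].
  case: (hE m) => _ _; apply => // Em; apply: nE.
  by exists m.
Qed.

(** If the annealed return probability were at least 1, stationarity would give a mean of at least 1
    from every generation [k], while the quenched value is at most 1. Each event [G k] would then be
    null, yet their countable union has full measure by [esc]. *)
Lemma transient_of_escape x :
  Q.-negligible [set w | ~ exists k, hit_prob x (shiftn k (envseq env w)) <= (2^-1)%:E] ->
  transient_state Q env x.
Proof.
move=> esc; rewrite /transient_state ltNge; apply/negP => ret.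
pose F (e : envseqT R) := hit_prob x (fun i => absenv (e i)).
have mF : measurable_fun [set: envseqT R] F := measurable_hit_prob x.
pose sh k : {mfun Omega >-> envseqT R} := HB.pack (fun w => shiftn k (envseq env w) : envseqT R)
   (isMeasurableFun.Build _ _ _ _ _ (measurable_shifted_envseq menv k)).
have FE k w : F (sh k w) = hit_prob x (shiftn k (envseq env w)).
  by rewrite /F /=; congr hit_prob; apply: funext => i; exact: envE.
have F1 k w : F (sh k w) <= 1 by rewrite FE; apply: hit_prob_le1 => i; exact: env_pmf.
have F0 k w : 0 <= F (sh k w) by rewrite FE; apply: hit_prob_ge0 => i; exact: env_pmf.
have mFk k : measurable_fun [set: Omega] (F \o sh k).
  exact: (measurableT_comp mF (measurable_shifted_envseq menv k)).
have mq n : measurable_fun [set: Omega] (fun w => qhit n.+1 (envseq env w) x x).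
  have := measurableT_comp (@measurable_qhit R n.+1 x x)
    (measurable_shifted_envseq menv 0).
  congr (measurable_fun _ _); apply: funext => w; rewrite /comp; congr qhit.
  by apply: funext => i; rewrite envE /shiftn addn0.
have q0 n w : setT w -> 0 <= qhit n.+1 (envseq env w) x x.
  by move=> _; apply: qhit_ge0 => i k; exact: env_ge0.
have ret0 : 1 <= \int[Q]_w F (sh 0%N w).
  apply: le_trans ret _; rewrite /return_prob.
  have <- := @integral_nneseries _ _ _ Q setT measurableT
    (fun n w => qhit n.+1 (envseq env w) x x) mq q0.
  by under [leRHS]eq_integral do rewrite FE shiftn0.
have retk k : 1 <= \int[Q]_w F (sh k w).
  rewrite (integral_same_law (psi := sh 0%N))// => B mB /=.
  exact: etrans (envseq_stationary menv iid k mB)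
    (esym (envseq_stationary menv iid 0 mB)).
pose G k := [set w | F (sh k w) <= (2^-1)%:E].
have mG k : measurable (G k).
  have := measurable_lee measurableT (mFk k) (measurable_cst (2^-1)%:E).
  by rewrite setTI.
have G0 k : Q.-negligible (G k).
  apply/negligibleP => //; apply/eqP; rewrite eq_le measure_ge0 andbT.
  (* On [G k] the quenched return probability leaves room for another [1/2], so [F + g <= 1]
     everywhere; integrating gives [1 + Q (G k) / 2 <= 1]. *)
  pose g w := (2^-1)%:E * (\1_(G k) w : R)%:E.
  have mg : measurable_fun [set: Omega] g.
    by apply/measurable_EFinP; apply: measurable_funM => //; exact: measurable_indic.
  have g0 w : 0 <= g w by rewrite mule_ge0// lee_fin.
  have : \int[Q]_w (F (sh k w) + g w) <= \int[Q]_w cst 1 w.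
    apply: le_integral_of_ge0 => w; first by rewrite adde_ge0.
    rewrite /g indicE; have [/set_mem wG|_] := boolP (w \in G k).
      rewrite mule1 (_ : cst 1 w = (2^-1)%:E + (2^-1)%:E); first exact: leeD.
      by rewrite -EFinD /=; congr EFin; field.
    by rewrite mule0 adde0.
  have -> : \int[Q]_w cst (1 : \bar R) w = 1.
    by rewrite integral_cst//= probability_setT mule1.
  rewrite ge0_integralD//; last exact: mFk.
  have -> : \int[Q]_w g w = (2^-1)%:E * Q (G k).
    rewrite /g ge0_integralZl//; first by rewrite integral_indic// setIT.
    by apply/measurable_EFinP; exact: measurable_indic.
  move=> h; have : 1 + (2^-1)%:E * Q (G k) <= 1.
    exact: (le_trans (leeD (retk k) (le_refl _)) h).
  have [q qE] : exists q : R, Q (G k) = q%:E.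
    by exists (fine (Q (G k))); rewrite fineK// fin_num_measure.
  rewrite qE -EFinM -EFinD lee_fin gerDl pmulr_rle0 ?invr_gt0// => hq.
  by apply: (@le_trans _ _ q%:E); [rewrite -qE|rewrite lee_fin].
have nT : Q.-negligible [set: Omega].
  apply: negligibleS (negligibleU (negligible_bigcup G0) esc) => w _.
  have [[k hk]|h] := pselect (exists k, hit_prob x (shiftn k (envseq env w)) <= (2^-1)%:E).
    have hF : F (sh k w) <= (2^-1)%:E by rewrite FE.
    by left; exists k; [|exact: hF].
  by right.
have := probability_setT Q; have /negligibleP -> // := nT.
by move/eqP; rewrite eq_sym onee_eq0.
Qed.

Lemma transient_of_immigration_tail (lambda c : R) x : (0 < lambda < 2)%R -> (0 < c)%R ->
  (\forall t \near +oo%R,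
    c%:E <= (t `^ lambda)%:E * Q [set w | (t < ln ((env 0%N w).2)%:R)%R]) ->
  transient_state Q env x.
Proof.
move=> hl c0 hc; apply: transient_of_escape.
have [rho r1 neg] := separated_eventually x hl c0 hc.
apply: negligibleS (negligibleU not_good_negligible neg) => w /= nk.
have [g|ng] := pselect (forall i, good (env i w)); last by left.
right; split => // -[m0 hm]; apply: nk.
exact: (@hit_prob_le_half R (envseq env w) x (fun m => rho ^+ m)%R m0).
Qed.

End Annealed.

Unset Implicit Arguments.

Theorem theorem1p3 (R : realType) (d : measure_display) (Omega : measurableType d)
  (Q : probability Omega R) (env : nat -> Omega -> envval R) (S : set nat) :
  (* each (phi_n, M_n) is a random element *)
  (forall i B, env_meas B -> measurable (env i @^-1` B)) ->
  (* phi_n is the p.g.f. of a probability distribution on N_0 *)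
  (forall i w k, 0 <= (env i w).1 k) ->
  (forall i w, (\sum_(k <oo) ((env i w).1 k)%:E)%E = 1%E) ->
  (* (Z_n) is irreducible on its state space N or N_0 *)
  (S = setT \/ S = [set n | (0 < n)%N]) ->
  irreducible_on Q env S ->
  (* (1) *)
  env_iid Q env ->
  (* (2) *)
  (forall delta : R, 0 < delta < 6 ->
     (\int[Q]_w (`| elog (mean (env 0%N w).1) | `^ delta) < +oo)%E) ->
  (\int[Q]_w elog (mean (env 0%N w).1))%E = 0%E ->
  (* (3) *)
  (\int[Q]_w (logplus (var_ratio (env 0%N w).1) *
              logplus (var_ratio (env 0%N w).1)) < +oo)%E ->
  (* (4) *)
  (exists lambda : R, 0 < lambda < 2 /\
     exists c : R, 0 < c /\
       \forall t \near +oo,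
         (c%:E <= (t `^ lambda)%:E * Q [set w | (t < ln ((env 0%N w).2)%:R)%R])%E) ->
  (* conclusion: (Z_n) is transient, i.e. every state is transient *)
  forall x, S x -> transient_state Q env x.
Proof.
move=> menv env0 env1 _ _ iid h2 h20 h3 [lambda [hl [c [c0 hc]]]] x _.
exact: (transient_of_immigration_tail menv env0 env1 iid h2 h20 h3 x hl c0 hc).
Qed.
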